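(* Let $d\ge 1$, $r\ge1$, $k\ge 1$ and $0\le e<d$ be integers with $k\mid d$ and $k\mid r$. Then the sequence $\mathbf{S}^{(d,e,k)}=(S_0^{(d,e,k)},S_1^{(d,e,k)},\ldots)$, where $S_n^{(d,e,k)}=Q_{dn+e}(r,d,k)\setminus\{\hat 0\}$, is an exponential Dowling structure (for the group $G'=\mu_r$) associated with the exponential structure $\mathbf{R}'^{(d,k)}=(R_1'^{(d,k)},R_2'^{(d,k)},\ldots)$.
   Context: Dowling lattices. Write $[N]=\{1,\dots,N\}$, and identify the group $\mu_r$ of complex $r$-th roots of unity with $\mathbb{Z}/r\mathbb{Z}$. For a finite group $G'$, a $G'$-prepartition is a triple $(I,\pi,\lambda)$, where $I\subseteq[N]$ (the zero block, possibly empty), $\pi=B_1\mid\cdots\mid B_l$ is a partition of $[N]\setminus I$ into nonempty blocks (the nonzero blocks), and $\lambda:[N]\setminus I\to G'$ is a map. Two prepartitions are equivalent if they have the same $I$ and the same $\pi$ and, for each block $B_i$, their labellings restricted to $B_i$ differ by right multiplication by an element of $G'$ (depending on the block). The elements of $Q_N(G')$ are the equivalence classes; the order is generated by the covering relations: $\alpha$ is covered by $\beta$ if $\beta$ is obtained from $\alpha$ either by merging a nonzero block into the zero block, or by merging two nonzero blocks $B_i,B_j$ into $B_i\cup B_j$ with labelling $\lambda$ on $B_i$ and $\lambda\cdot g$ on $B_j$ for some $g\in G'$. $Q_N(r):=Q_N(\mu_r)$. The minimum $\hat 0$ has $I=\emptyset$ and all nonzero blocks singletons. $Q_N(r,d,k)$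 is the subposet of $Q_N(r)$ consisting of $\hat 0$ together with the elements all of whose nonzero blocks $B_i$ have size divisible by $d$ and are such that $|\{a\in B_i\mid\lambda(a)\equiv j\pmod k\}|$ is independent of $j$; the case $d=1$ is allowed, and then $Q_N(r,1,1)=Q_N(r)$. $\Pi_n$ is the lattice of partitions of an $n$-element set, ordered by refinement. By convention $S_0^{(d,e,k)}$ is the one-element poset (also when $e=0$). For $n\ge 1$ let $c_n\in Q_{dn}(r,d,k)$ be the element with empty zero block, a single nonzero block $\{1,2,\dots,dn\}$, and labelling $\lambda(i)=\lfloor\frac{(i-1)k}{dn}\rfloor+1$. $R_n'^{(d,k)}$ is the lower order ideal generated by $c_n$ in $Q_{dn}(r,d,k)$ without the adjoined minimum, that is, the poset of those elements $x\le c_n$ all of whose nonzero blocks satisfy the two conditions above (size divisible by $d$, and labels evenly distributed modulo $k$). An exponential structure $\mathbf{R}=(R_1,R_2,\ldots)$ is a sequence of posets such that: (E1) $R_n$ has a unique maximal element $\hat 1$ and every maximal chain in $R_n$ contains $n$ elements; (E2) for $x\in R_n$ of rank $j$, $[x,\hat 1]\cong\Pi_{n-j}$; (E3) the lower order ideal generated by $x\in R_n$ is isomorphic to $R_1^{a_1}\times\cdots\times R_n^{a_n}$ for some $n$-tuple $(a_1,\dots,a_n)$, the type of $x$; (E4) $R_n$ has $M(n)$ minimal elements, and $(M(1),M(2),\ldots)$ is called the denominator sequence. For a finite group $G'$, an exponential Dowling structure $\mathbf{S}=(S_0,S_1,\ldots)$ associated to an exponential structure $\mathbf{R}$ is a sequence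 of posets such that: (D1) $S_n$ has a unique maximal element $\hat 1$ and every maximal chain in $S_n$ contains $n+1$ elements; (D2) for $x\in S_n$, $[x,\hat 1]\cong Q_{n-\operatorname{rk}(x)}(G')$; (D3) each $x\in S_n$ has a type $(b;a_1,\dots,a_n)$ assigned such that the lower order ideal generated by $x$ is isomorphic to $S_b\times R_1^{a_1}\times\cdots\times R_n^{a_n}$; (D4) $S_n$ has $N(n)$ minimal elements, and $(N(0),N(1),\ldots)$ is called the denominator sequence. Minimal elements of $R_n$ and $S_n$ have rank $0$.
   Formalization: For d=1 the minimum 0̂ is not removed, so S_n = Q_n(r): removing it would leave S_1 with one-element maximal chains, contradicting (D1); S_n is read as the poset of all elements whose nonzero blocks satisfy the two conditions. *)

(* Defs.v *)
From HB Require Import structures.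
From mathcomp Require Import all_boot all_order all_fingroup all_algebra.

Set Implicit Arguments.
Unset Strict Implicit.
Unset Printing Implicit Defensive.

Import Order.TTheory.
Local Open Scope order_scope.

Set Warnings "-redundant-canonical-projection,-projection-no-head-constant".

Fact poset_display : Order.disp_t. Proof. exact: Order.Disp tt tt. Qed.

Notation finPoset := (finPOrderType poset_display).

Definition poset_iso d d' (T : porderType d) (U : porderType d') : Prop :=
  exists f : T -> U, bijective f /\ {mono f : x y / x <= y}.

Definition subposet d (T : finPOrderType d) (P : pred T) : Type :=
  {x : T | P x}.
HB.instance Definition _ d (T : finPOrderType d) (P : pred T) :=
  SubFinite.on (subposet P).
HB.instance Definition _ d (T : finPOrderType d) (P : pred T) :=
  [SubChoice_isSubPOrder of subposet P by <: with d].

Section DependentProduct.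
Variables (d : Order.disp_t) (I : finType) (T : I -> finPOrderType d).

Definition dprod_poset : Type := {dffun forall i, T i}.
HB.instance Definition _ := Finite.on dprod_poset.

Definition dprod_le : rel dprod_poset := fun f g => [forall i, f i <= g i].

Fact dprod_le_refl : reflexive dprod_le.
Proof. by move=> f; apply/forallP. Qed.

Fact dprod_le_anti : antisymmetric dprod_le.
Proof.
move=> f g /andP[/forallP fg /forallP gf]; apply/ffunP => i.
by apply/le_anti; rewrite fg gf.
Qed.

Fact dprod_le_trans : transitive dprod_le.
Proof.
move=> g f h /forallP fg /forallP gh; apply/forallP => i.
exact: le_trans (fg i) (gh i).
Qed.

HB.instance Definition _ :=
  Order.Le_isPOrder.Build d dprod_poset
    dprod_le_refl dprod_le_anti dprod_le_trans.
End DependentProduct.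

Section FinitePosets.
Variables (d : Order.disp_t) (T : finPOrderType d).
Implicit Types (x y : T) (C : {set T}).

Definition is_maximal x := [forall y, (x <= y) ==> (y == x)].
Definition is_minimal x := [forall y, (y <= x) ==> (y == x)].

Definition is_chain C := [forall x in C, forall y in C, x >=< y].
Definition is_max_chain C := maxset is_chain C.

(* One less than the largest size of a chain in the ideal below x, so that
   minimal elements have rank 0. *)
Definition rank x : nat :=
  (\max_(C : {set T} | is_chain C && [forall y in C, y <= x]) #|C|).-1.

Definition poset_interval x y := subposet [pred z | x <= z <= y].
Definition lower_ideal x := subposet [pred y | y <= x].
End FinitePosets.

HB.instance Definition _ d (T : finPOrderType d) (x y : T) :=
  Order.FinPOrder.on (poset_interval x y).
HB.instance Definition _ d (T : finPOrderType d) (x : T) :=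
  Order.FinPOrder.on (lower_ideal x).

Section PartitionLattice.
Variable T : finType.

Definition partition_lattice : Type :=
  {P : {set {set T}} | partition P [set: T]}.
HB.instance Definition _ := SubFinite.on partition_lattice.

Definition refines : rel partition_lattice := fun P Q =>
  [forall B in val P, exists C in val Q, B \subset C].

Fact refines_refl : reflexive refines.
Proof.
by move=> P; apply/forall_inP => B PB; apply/exists_inP; exists B.
Qed.

Fact refines_trans : transitive refines.
Proof.
move=> Q P R /forall_inP PQ /forall_inP QR; apply/forall_inP => B /PQ.
case/exists_inP => C /QR /exists_inP[D RD sCD] sBC.
by apply/exists_inP; exists D => //; apply: subset_trans sCD.
Qed.

Fact refines_anti : antisymmetric refines.
Proof.
suff sub P Q : refines P Q -> refines Q P -> val P \subset val Q.
  move=> P Q /andP[PQ QP]; apply/val_inj/eqP.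
  by rewrite eqEsubset !sub.
move=> /forall_inP PQ /forall_inP QP; apply/subsetP => B PB.
have /exists_inP[C QC sBC] := PQ _ PB.
have /exists_inP[D PD sCD] := QP _ QC.
have sBD : B \subset D by apply: subset_trans sCD.
have partP := valP P; have tiP := partition_trivIset partP.
have /set0Pn[a Ba] := partition_neq0 partP PB.
have eBD : B = D.
  by rewrite -(def_pblock tiP PB Ba) -(def_pblock tiP PD (subsetP sBD a Ba)).
suff -> : B = C by [].
by apply/eqP; rewrite eqEsubset sBC eBD.
Qed.

HB.instance Definition _ :=
  Order.Le_isPOrder.Build poset_display partition_lattice
    refines_refl refines_anti refines_trans.
End PartitionLattice.

Notation "'Pi_ n" := (partition_lattice 'I_n)
  (at level 8, n at level 2, format "''Pi_' n").

Section Dowling.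
Variables (T : finType) (G : finGroupType).

(* The labelling is total on the ground set; prepart_eqv disregards its
   values on the zero block, so the classes are those of labellings of the
   complement of the zero block. *)
Record prepart := Prepart {
  prepart_val : {set T} * {set {set T}} * {ffun T -> G};
  _ : partition prepart_val.1.2 (~: prepart_val.1.1) }.

HB.instance Definition _ := [isSub for prepart_val].
HB.instance Definition _ := [Finite of prepart by <:].

Implicit Types (p q : prepart).

Definition zero_block p : {set T} := (val p).1.1.
Definition blocks p : {set {set T}} := (val p).1.2.
Definition label p : {ffun T -> G} := (val p).2.

Definition prepart_eqv : rel prepart := fun p q =>
  [&& zero_block p == zero_block q, blocks p == blocks q
    & [forall B in blocks p, exists g : G, forall a in B,
         label q a == (label p a * g)%g]].

Definition dowling : Type :=
  {X : {set prepart} | X \in equivalence_partition prepart_eqv [set: prepart]}.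
HB.instance Definition _ := SubFinite.on dowling.

Implicit Types (x y z : dowling).

Definition merge_zero p q := [exists B in blocks p,
  [&& zero_block q == zero_block p :|: B,
      blocks q == blocks p :\ B
    & label q == label p]].

Definition merge_nonzero p q := [exists B in blocks p, exists B' in blocks p,
  exists g : G,
  [&& B != B',
      zero_block q == zero_block p,
      blocks q == (B :|: B') |: (blocks p :\ B :\ B')
    & label q == [ffun a => if a \in B' then (label p a * g)%g
                            else label p a]]].

Definition dowling_covers : rel dowling := fun x y =>
  [exists p in val x, exists q in val y, merge_zero p q || merge_nonzero p q].

Definition dowling_le : rel dowling := connect dowling_covers.

Lemma prepart_eqv_equiv :
  {in [set: prepart] & &, equivalence_rel prepart_eqv}.
Proof.
have rfl : reflexive prepart_eqv.
  move=> p; rewrite /prepart_eqv !eqxx /=.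
  apply/forall_inP => B _; apply/existsP; exists 1%g.
  by apply/forall_inP => a _; rewrite mulg1.
have sym : symmetric prepart_eqv.
  suff imp p q : prepart_eqv p q -> prepart_eqv q p.
    by move=> p q; apply/idP/idP; apply: imp.
  case/and3P => /eqP e1 /eqP e2 /forall_inP h.
  rewrite /prepart_eqv e1 e2 !eqxx /=; apply/forall_inP => B.
  rewrite -e2 => /h /existsP[g /forall_inP hg].
  apply/existsP; exists g^-1%g; apply/forall_inP => a /hg /eqP ->.
  by rewrite mulgK.
have tr : transitive prepart_eqv.
  move=> q p s /and3P[/eqP e1 /eqP e2 /forall_inP h].
  case/and3P => /eqP e1' /eqP e2' /forall_inP h'.
  rewrite /prepart_eqv e1 e2 e1' e2' !eqxx /=; apply/forall_inP => B pB.
  have /existsP[g' /forall_inP hg'] : [exists g : G, forall a in B,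
    label s a == (label q a * g)%g] by apply: h'; rewrite e2'.
  have /existsP[g /forall_inP hg] : [exists g : G, forall a in B,
    label q a == (label p a * g)%g] by apply: h; rewrite e2 e2'.
  apply/existsP; exists (g * g')%g; apply/forall_inP => a aB.
  by rewrite (eqP (hg' a aB)) (eqP (hg a aB)) mulgA.
move=> p q s _ _ _; split; first exact: rfl.
by move=> pq; apply/idP/idP; apply: tr; rewrite // sym.
Qed.

Fact dowling_class_subproof p :
  [set q | prepart_eqv p q]
    \in equivalence_partition prepart_eqv [set: prepart].
Proof.
by apply/imsetP; exists p; rewrite ?inE //; apply/setP => q; rewrite !inE.
Qed.

Definition dowling_class p : dowling := 
  exist _ [set q | prepart_eqv p q] (dowling_class_subproof p).

Lemma dowlingP x : exists p, x = dowling_class p.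
Proof.
have /imsetP[p _ e] := valP x; exists p; apply/val_inj; rewrite /= e.
by apply/setP => q; rewrite !inE.
Qed.

Lemma mem_dowling_class p : p \in val (dowling_class p).
Proof.
by rewrite inE; case: (prepart_eqv_equiv (in_setT p) (in_setT p) (in_setT p)).
Qed.

Lemma dowling_blocks x p q : p \in val x -> q \in val x ->
  (zero_block p = zero_block q) * (blocks p = blocks q).
Proof.
have [s ->] := dowlingP x; rewrite !inE.
by case/and3P => /eqP <- /eqP <- _ /and3P[/eqP <- /eqP <- _].
Qed.

Fact dowling_le_refl : reflexive dowling_le.
Proof. exact: connect0. Qed.

Fact dowling_le_trans : transitive dowling_le.
Proof. exact: connect_trans. Qed.

Lemma merge_card p q :
  merge_zero p q || merge_nonzero p q -> (#|blocks q| < #|blocks p|)%N.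
Proof.
case/orP => [/exists_inP[B pB /and3P[_ /eqP -> _]]|].
  by rewrite (cardsD1 B (blocks p)) pB.
case/exists_inP => B pB /exists_inP[B' pB' /existsP[g]].
case/and4P => nBB' _ /eqP -> _.
rewrite (cardsD1 B (blocks p)) pB (cardsD1 B' (blocks p :\ B)).
rewrite !inE eq_sym nBB' pB' cardsU1 !add1n !ltnS.
by case: (_ \notin _) => //=; rewrite add0n leqnSn.
Qed.

Fact dowling_le_anti : antisymmetric dowling_le.
Proof.
have lt_blocks x y : dowling_covers x y -> forall p q,
    p \in val x -> q \in val y -> (#|blocks q| < #|blocks p|)%N.
  case/exists_inP => p' xp' /exists_inP[q' yq' pq'] p q xp yq.
  by rewrite (dowling_blocks xp xp') (dowling_blocks yq yq') merge_card.
have le_blocks x y : dowling_le x y -> forall p q,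
    p \in val x -> q \in val y -> (#|blocks q| <= #|blocks p|)%N.
  case/connectP => s; elim: s x => [|z s IHs] x /= => [_ ->|].
    by move=> p q xp xq; rewrite (dowling_blocks xp xq).
  case/andP => xz zs ey p q xp yq; have [w ez] := dowlingP z.
  have zw : w \in val z by rewrite ez mem_dowling_class.
  exact: leq_trans (IHs z zs ey w q zw yq) (ltnW (lt_blocks _ _ xz _ _ xp zw)).
move=> x y /andP[/connectP[[|z s] /= ps ey] yx]; first by rewrite ey.
case/andP: ps => xz zs; have [w ez] := dowlingP z; have [p ex] := dowlingP x.
have zw : w \in val z by rewrite ez mem_dowling_class.
have xp : p \in val x by rewrite ex mem_dowling_class.
have zx : dowling_le z x.
  by apply: dowling_le_trans yx; apply/connectP; exists s.
by have := leq_trans (lt_blocks _ _ xz _ _ xp zw) (le_blocks _ _ zx _ _ zw xp);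
  rewrite ltnn.
Qed.

HB.instance Definition _ :=
  Order.Le_isPOrder.Build poset_display dowling
    dowling_le_refl dowling_le_anti dowling_le_trans.

Definition is_hat0 x := [forall p in val x,
  (zero_block p == set0) && [forall B in blocks p, #|B| == 1]].
End Dowling.

(* Q_N(G), with [N] represented by 'I_N *)
Notation DowlingQ N G := (dowling 'I_N G).

(* The additive group Z/r, for r > 0.  Not 'Z_r, which is Z/2 for r = 1. *)
Notation mu r := 'I_r.-1.+1.

Section EvenBlocks.
Variables (r N : nat).

(* For k %| r, the residue mod k of an element of mu r is well defined, and
   right multiplication of the labels permutes the residue classes, so that the
   choice of the representative p is irrelevant. *)
Definition even_blocks (d k : nat) (x : DowlingQ N (mu r)) :=
  [forall p in val x, forall B in blocks p,
    (d %| #|B|)%N &&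
    [forall j : 'I_k, forall j' : 'I_k,
      #|[set a in B | label p a == j %[mod k]]|
      == #|[set a in B | label p a == j' %[mod k]]|]].

(* membership in Q_N(r,d,k) *)
Definition in_Qrdk (d k : nat) (x : DowlingQ N (mu r)) :=
  is_hat0 x || even_blocks d k x.

Lemma even_blocksE d k (x : DowlingQ N (mu r)) : (1 < d)%N -> (0 < N)%N ->
  even_blocks d k x = in_Qrdk d k x && ~~ is_hat0 x.
Proof.
move=> d1 N0; rewrite /in_Qrdk; case h0: (is_hat0 x); rewrite ?andbT //=.
apply: contraTF d1 => /forall_inP ev.
have [p ex] := dowlingP x.
have xp : p \in val x by rewrite ex mem_dowling_class.
have /andP[/eqP z0 /forall_inP b1] := forall_inP h0 p xp.
have pp : partition (blocks p) (~: zero_block p) := valP p.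
have cB : Ordinal N0 \in cover (blocks p).
  by rewrite (cover_partition pp) z0 !inE.
have pB := pblock_mem cB.
have /andP[] := forall_inP (ev p xp) _ pB.
by rewrite (eqP (b1 _ pB)) dvdn1 => /eqP ->.
Qed.
End EvenBlocks.

(* S_n^(d,e,k) = Q_{dn+e}(r,d,k) minus the adjoined minimum.  By even_blocksE
   this is the set-theoretic Q_{dn+e}(r,d,k) \ {hat0} when d > 1 and dn+e > 0.
   When d = 1 the minimum hat0 satisfies the block conditions, hence is already
   present without being adjoined, and S_n^(1,0,1) is the Dowling lattice
   Q_n(r), which has n+1 elements in each maximal chain; removing hat0 would
   leave only n.  The one-element convention for S_0 is S0_card below. *)
Definition S_seq (r d e k n : nat) : finPoset :=
  subposet [pred x : DowlingQ (d * n + e) (mu r) | even_blocks d k x].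

Section CN.
Variables (r d k n : nat).

(* set0 is removed only to get a partition when d * n = 0 *)
Fact c_elt_subproof :
  partition ([set [set: 'I_(d * n)]] :\ set0) (~: (set0 : {set 'I_(d * n)})).
Proof.
rewrite setC0; have [e|n0] := eqVneq [set: 'I_(d * n)] set0.
  by rewrite e setDv partition_set0.
apply/and3P; split; last by rewrite !inE eqxx.
- rewrite /cover (_ : _ :\ _ = [set setT]) ?big_set1 //.
  by apply/setP => B; rewrite !inE; case: eqVneq => // ->; rewrite eq_sym (negPf n0).
- by apply: trivIsetD; apply: trivIset1.
Qed.

(* i : 'I_(d * n) stands for the element i+1 of [dn] *)
Definition c_elt : DowlingQ (d * n) (mu r) :=
  dowling_class (@Prepart _ _
    (set0, [set [set: 'I_(d * n)]] :\ set0,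
     [ffun i : 'I_(d * n) => inZp ((i * k) %/ (d * n) + 1) : mu r])
    c_elt_subproof).

Definition R'_seq : finPoset :=
  subposet [pred x | even_blocks d k x & x <= c_elt].
End CN.

Lemma S0_card r d e k : (e < d)%N -> #|{: S_seq r d e k 0}| = 1.
Proof.
move=> ed.
have NE : (d * 0 + e = e)%N by rewrite muln0.
have p0P : partition (set0 : {set {set 'I_(d * 0 + e)}}) (~: setT).
  by rewrite setCT partition_set0.
pose p0 : prepart 'I_(d * 0 + e) (mu r) :=
  @Prepart _ _ (setT, set0, [ffun=> 1%g]) p0P.
have S0 : even_blocks d k (dowling_class p0).
  apply/forall_inP => p; rewrite inE => /and3P[_ /eqP eb _].
  by apply/forall_inP => B; rewrite -eb inE.
apply: (@eq_card1 _ (exist _ (dowling_class p0) S0)) => -[x Sx].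
rewrite !inE; apply/esym/eqP/val_inj => /=.
have [p ex] := dowlingP x.
have xp : p \in val x by rewrite ex mem_dowling_class.
have pp : partition (blocks p) (~: zero_block p) := valP p.
have b0 : blocks p = set0.
  apply/setP => B; rewrite !inE; apply/negP => pB.
  have /andP[dB _] := forall_inP (forall_inP Sx p xp) B pB.
  have B0 : (0 < #|B|)%N by rewrite card_gt0 (partition_neq0 pp pB).
  have := leq_trans (dvdn_leq B0 dB) (max_card _).
  by rewrite card_ord NE leqNgt ed.
have z1 : zero_block p = setT.
  apply: setC_inj; rewrite -(cover_partition pp) b0 setCT.
  by rewrite /cover big_set0.
rewrite ex; apply/val_inj/setP => q; rewrite !inE /prepart_eqv b0 z1.
have -> : zero_block p0 = setT by [].
have -> : blocks p0 = set0 by [].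
by congr [&& _, _ & _]; apply/forallP/forallP => _ B; rewrite inE.
Qed.

(* R_1^(a_1) * ... * R_n^(a_n), where a_(i+1) is a i for i : 'I_n *)
Definition type_prod (R : nat -> finPoset) n (a : 'I_n -> nat) : finPoset :=
  dprod_poset (fun t : {i : 'I_n & 'I_(a i)} => R (tag t).+1).

(* R n is R_n for n > 0; R 0 is ignored. *)
Record exponential_structure_with (R : nat -> finPoset) (M : nat -> nat) : Prop
:= ExponentialStructure {
  exp_E1_max : forall n, (0 < n)%N -> exists! t : R n, is_maximal t;
  exp_E1_chain : forall n, (0 < n)%N ->
    forall C : {set R n}, is_max_chain C -> #|C| = n;
  exp_E2 : forall n, (0 < n)%N -> forall x t : R n, is_maximal t ->
    poset_iso (poset_interval x t) 'Pi_(n - rank x);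
  exp_E3 : forall n, (0 < n)%N -> forall x : R n,
    exists a : 'I_n -> nat, poset_iso (lower_ideal x) (type_prod R a);
  exp_E4 : forall n, (0 < n)%N -> #|[set x : R n | is_minimal x]| = M n }.

Definition exponential_structure (R : nat -> finPoset) : Prop :=
  exists M : nat -> nat, exponential_structure_with R M.

Record exponential_Dowling_structure_with (G : finGroupType)
    (R S : nat -> finPoset) (N : nat -> nat) : Prop
:= ExponentialDowlingStructure {
  exp_D0 : exponential_structure R;
  exp_D1_max : forall n, exists! t : S n, is_maximal t;
  exp_D1_chain : forall n (C : {set S n}), is_max_chain C -> #|C| = n.+1;
  exp_D2 : forall n (x t : S n), is_maximal t ->
    poset_iso (poset_interval x t) (DowlingQ (n - rank x) G);
  exp_D3 : forall n (x : S n), exists (b : nat) (a : 'I_n -> nat),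
    poset_iso (lower_ideal x) (S b *prod[poset_display] type_prod R a);
  exp_D4 : forall n, #|[set x : S n | is_minimal x]| = N n }.

(* S is an exponential Dowling structure for the group G, associated to R *)
Definition exponential_Dowling_structure (G : finGroupType)
    (R S : nat -> finPoset) : Prop :=
  exists N : nat -> nat, exponential_Dowling_structure_with G R S N.

(* Main.v *)
(** The proof represents an element of [Q_N(G)] by a function [f] from [N] to
    pairs (block name, label), undefined on the zero block, and compares two
    such functions by the inclusion of their kernels
    [{(a, b, g) | f a = g f b}]: this turns the order generated by the merging
    steps into a first-order condition, and makes precomposition with a
    labelled map [T' -> T x G] a monotone pullback.

    If [x] has [l] nonzero blocks, the elements above [x] are the pullbacks of
    the elements of [Q_l(G)] along the map sending [a] to its (block, label)
    in [x]; those below [c_n] are determined by a partition of the set of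
    blocks.  The elements below [x] are the disjoint unions of their
    restrictions to the zero block and to the blocks of [x].  A block of size
    [d * m] has the same number of labels in each class mod [k] as [c_m], so
    it can be identified with [1..dm] in such a way that its labels match those
    of [c_m] mod [k], and evenness only depends on the labels mod [k].

    For the grading, the number of nonzero blocks drops by one along each
    merging, evenness is preserved upwards, and an even element with fewer
    than [n] blocks can be refined: either some block contains a proper
    subset with [d / k] labels in each class, or all blocks have size [d] and
    [d] elements of the zero block can be turned into a new one. *)
Require Import Defs.
From mathcomp Require Import all_boot all_order all_fingroup all_algebra.

Set Implicit Arguments.
Unset Strict Implicit.
Unset Printing Implicit Defensive.

Import Order.TTheory.
Local Open Scope group_scope.

(** * Kernels of prepartitions *)

Section Act.
Variables (G : finGroupType) (J : Type).
Implicit Types (g h : G) (o : option (J * G)).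

(** The group acts on labels from the left, whereas equivalent labellings differ on a block by right
    multiplication. The ratios [u * v^-1] of two labels in one block are therefore invariants of the
    class, and [f a = lact g (f b)] records such a ratio. *)
Definition lact g o := omap (fun z => (z.1, g * z.2)) o.

Lemma lact1 o : lact 1 o = o.
Proof. by case: o => // -[j u]; rewrite /lact /= mul1g. Qed.

Lemma lactM g h o : lact (g * h) o = lact g (lact h o).
Proof. by case: o => // -[j u]; rewrite /lact /= mulgA. Qed.

Lemma lact_None g o : lact g o = None <-> o = None.
Proof. by case: o. Qed.

Lemma lact_canl g o o' : lact g o = o' <-> o = lact g^-1 o'.
Proof. by split=> [<-|->]; rewrite -lactM ?mulVg ?mulgV lact1. Qed.

Lemma lact_Some j u v : Some (j, u) = lact (u * v^-1) (Some (j, v)).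
Proof. by rewrite /lact /= mulgKV. Qed.
End Act.

Section Kernel.
Variables (T : finType) (G : finGroupType).

Definition kernel_le J J' (f : T -> option (J * G)) (f' : T -> option (J' * G)) :=
  (forall a, f a = None -> f' a = None) /\
  (forall a b g, f a = lact g (f b) -> f' a = lact g (f' b)).

Lemma kernel_le_trans J1 J2 J3 (f1 : T -> option (J1 * G)) (f2 : T -> option (J2 * G))
  (f3 : T -> option (J3 * G)) : kernel_le f1 f2 -> kernel_le f2 f3 -> kernel_le f1 f3.
Proof.
by move=> [z12 k12] [z23 k23]; split=> [a /z12/z23|a b g /k12/k23].
Qed.

(** Left multiplication is free on labels, so for two elements of one nonzero block the only
    possible [g] is the ratio of their labels. *)
Lemma kernel_leP J J' (f : T -> option (J * G)) (f' : T -> option (J' * G)) :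
  (forall a, f a = None -> f' a = None) ->
  (forall a b j u v, f a = Some (j, u) -> f b = Some (j, v) ->
    f' a = lact (u * v^-1) (f' b)) -> kernel_le f f'.
Proof.
move=> z kk; split=> // a b g.
case eb: (f b) => [[j v]|] /= ea; last by rewrite (z _ ea) (z _ eb).
by rewrite (kk _ _ _ _ _ ea eb) mulgK.
Qed.

Definition prep_fun (p : prepart T G) a :=
  if a \in zero_block p then None else Some (pblock (blocks p) a, label p a).

Lemma prep_partition (p : prepart T G) : partition (blocks p) (~: zero_block p).
Proof. exact: valP p. Qed.

Lemma prep_trivIset (p : prepart T G) : trivIset (blocks p).
Proof. exact: partition_trivIset (prep_partition p). Qed.

Lemma mem_prep_block (p : prepart T G) B a :
  B \in blocks p -> a \in B -> (a \notin zero_block p) * (pblock (blocks p) a = B).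
Proof.
move=> pB aB; split; last exact: def_pblock (prep_trivIset p) pB aB.
have := cover_partition (prep_partition p) => /setP/(_ a); rewrite inE => <-.
by apply/bigcupP; exists B.
Qed.

Lemma prep_fun_block (p : prepart T G) B a :
  B \in blocks p -> a \in B -> prep_fun p a = Some (B, label p a).
Proof.
move=> pB aB; have [za e] := mem_prep_block pB aB.
by rewrite /prep_fun (negPf za) e.
Qed.

Lemma prep_cover (p : prepart T G) a :
  a \notin zero_block p ->
  (a \in pblock (blocks p) a) * (pblock (blocks p) a \in blocks p).
Proof.
rewrite -in_setC -(cover_partition (prep_partition p)) => ca.
by rewrite mem_pblock ca pblock_mem.
Qed.

Lemma prep_fun_Some (p : prepart T G) B a u :
  prep_fun p a = Some (B, u) -> [/\ B \in blocks p, a \in B & label p a = u].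
Proof. by rewrite /prep_fun; case: ifP => // /negbT/prep_cover[h1 h2] [<- <-]. Qed.

Lemma prep_fun_None (p : prepart T G) a :
  prep_fun p a = None <-> a \in zero_block p.
Proof. by rewrite /prep_fun; case: ifP. Qed.

Lemma prepart_eqv_kernel (p q : prepart T G) :
  prepart_eqv p q <-> kernel_le (prep_fun p) (prep_fun q) /\ kernel_le (prep_fun q) (prep_fun p).
Proof.
split.
  case/and3P=> /eqP ez /eqP eb /forall_inP el.
  split; apply: kernel_leP => [a /prep_fun_None za|a b B u v].
  - by apply/prep_fun_None; rewrite -ez.
  - case/prep_fun_Some=> pB aB <- /prep_fun_Some[_ bB <-].
    have /existsP[g /forall_inP hg] := el B pB.
    rewrite !(@prep_fun_block _ B) -?eb //= (eqP (hg a aB)) (eqP (hg b bB)).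
    by rewrite !mulgA mulgKV.
  - by apply/prep_fun_None; rewrite ez.
  - case/prep_fun_Some=> qB aB <- /prep_fun_Some[_ bB <-].
    have pB : B \in blocks p by rewrite eb.
    have /existsP[g /forall_inP hg] := el B pB.
    rewrite !(@prep_fun_block _ B) //= (eqP (hg a aB)) (eqP (hg b bB)).
    by rewrite invMg !mulgA mulgK mulgKV.
case=> [[zpq kpq] [zqp kqp]].
have ez : zero_block p = zero_block q.
  by apply/setP => a; apply/idP/idP => /prep_fun_None h; apply/prep_fun_None; auto.
have imp (p' q' : prepart T G) a b : kernel_le (prep_fun p') (prep_fun q') ->
    a \notin zero_block p' -> a \notin zero_block q' -> b \notin zero_block p' ->
    pblock (blocks p') a = pblock (blocks p') b ->
    pblock (blocks q') a = pblock (blocks q') b.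
  case=> _ kk za za' zb e.
  have := kk a b (label p' a * (label p' b)^-1).
  rewrite /prep_fun (negPf za) (negPf za') (negPf zb) e -lact_Some => /(_ erefl).
  by case: ifP => // _ /= [].
(* Both partitions are recovered as the fibres of [pblock] outside the common zero block, so it is
   enough that the two kernels identify the same pairs. *)
have eb : blocks p = blocks q.
  rewrite -(preim_partition_pblock (prep_partition p)).
  rewrite -(preim_partition_pblock (prep_partition q)) ez.
  apply: eq_in_imset => a; rewrite inE => za; apply/setP => b.
  rewrite !inE; case: (boolP (b \in zero_block q)) => //= zb.
  by apply/eqP/eqP => e; [apply: (@imp p q)|apply: (@imp q p)]; rewrite ?ez.
rewrite /prepart_eqv ez eb !eqxx /=; apply/forall_inP => B qB.
have /set0Pn[b bB] := partition_neq0 (prep_partition q) qB.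
have pB : B \in blocks p by rewrite eb.
(* The right multiplier of the block is read off at one element [b]; equality of ratios carries it
   to every other [a]. *)
apply/existsP; exists ((label p b)^-1 * label q b); apply/forall_inP => a aB.
have := kpq a b (label p a * (label p b)^-1).
rewrite !(prep_fun_block pB) // !(prep_fun_block qB) // -lact_Some => /(_ erefl).
by rewrite /= => -[->]; rewrite mulgA.
Qed.

Lemma dowling_class_eq (p q : prepart T G) :
  dowling_class p = dowling_class q <-> prepart_eqv p q.
Proof.
split=> [e|pq]; first by have := mem_dowling_class q; rewrite -e inE.
apply/val_inj/setP => s; rewrite !inE.
by have [_ ->] := prepart_eqv_equiv (in_setT p) (in_setT q) (in_setT s).
Qed.

Lemma mem_dowling (x : dowling T G) p : p \in val x -> x = dowling_class p.
Proof. by have [q ->] := dowlingP x; rewrite inE => h; apply/dowling_class_eq. Qed.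

(** A merging either sends a whole block to the zero block or multiplies the labels of an old block
    on the right by a single element, which does not change their ratios. *)
Lemma merge_kernel_le (p q : prepart T G) :
  merge_zero p q || merge_nonzero p q -> kernel_le (prep_fun p) (prep_fun q).
Proof.
case/orP.
  case/exists_inP=> B pB /and3P[/eqP ez /eqP eb /eqP el].
  apply: kernel_leP => [a /prep_fun_None|a b C u v].
    by move=> za; apply/prep_fun_None; rewrite ez inE za.
  case/prep_fun_Some=> pC aC <- /prep_fun_Some[_ bC <-].
  have [eC|nC] := eqVneq C B.
    rewrite /prep_fun (_ : a \in zero_block q); last by rewrite ez inE -eC aC orbT.
    by rewrite (_ : b \in zero_block q) // ez inE -eC bC orbT.
  have qC : C \in blocks q by rewrite eb !inE nC.
  by rewrite !(prep_fun_block qC) //= el mulgKV.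
case/exists_inP=> B pB /exists_inP[B' pB' /existsP[g]].
case/and4P=> nBB' /eqP ez /eqP eb /eqP el.
have lE a : label q a = if a \in B' then label p a * g else label p a.
  by rewrite el ffunE.
apply: kernel_leP => [a /prep_fun_None|a b C u v].
  by move=> za; apply/prep_fun_None; rewrite ez.
case/prep_fun_Some=> pC aC <- /prep_fun_Some[_ bC <-].
have nB'B a' : a' \in B -> a' \in B' = false.
  move=> aB; apply: contraNF nBB' => aB'.
  by rewrite -(mem_prep_block pB aB) (mem_prep_block pB' aB').
have nB'C a' : C != B' -> a' \in C -> a' \in B' = false.
  move=> nC aB; apply: contraNF nC => aB'.
  by rewrite -(mem_prep_block pC aB) (mem_prep_block pB' aB').
have [eC|nC] := eqVneq C B'; [|have [eC'|nC'] := eqVneq C B].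
- rewrite !(@prep_fun_block _ (B :|: B')) ?eb ?inE -?eC ?aC ?bC ?eqxx ?orbT //=.
  by rewrite !lE -eC aC bC mulgA mulgKV.
- rewrite !(@prep_fun_block _ (B :|: B')) ?eb ?inE -?eC' ?aC ?bC ?eqxx ?orbT //=.
  by rewrite !lE !nB'C // mulgKV.
have qC : C \in blocks q by rewrite eb !inE nC nC' pC orbT.
by rewrite !(prep_fun_block qC) //= !lE !nB'C // mulgKV.
Qed.

Lemma merge_nonzero_block (p : prepart T G) B B' :
  B \in blocks p -> B' \in blocks p -> B != B' ->
  B :|: B' \notin blocks p :\ B :\ B'.
Proof.
move=> pB pB' nBB'; rewrite !inE; apply/negP=> /and3P[_ /eqP nB pU].
have /set0Pn[a aB] := partition_neq0 (prep_partition p) pB.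
have aU : a \in B :|: B' by rewrite inE aB.
by apply: nB; rewrite -(mem_prep_block pU aU) (mem_prep_block pB aB).
Qed.

(** The union of two blocks is never already a block, so the count drops by exactly one. This
    equality is the source of the grading. *)
Lemma merge_card_eq (p q : prepart T G) :
  merge_zero p q || merge_nonzero p q -> #|blocks p| = #|blocks q|.+1.
Proof.
case/orP=> [/exists_inP[B pB /and3P[_ /eqP -> _]]|].
  by rewrite (cardsD1 B (blocks p)) pB.
case/exists_inP=> B pB /exists_inP[B' pB' /existsP[g]].
case/and4P=> nBB' _ /eqP -> _.
rewrite (cardsD1 B (blocks p)) pB (cardsD1 B' (blocks p :\ B)).
by rewrite cardsU1 merge_nonzero_block // !inE eq_sym nBB' pB'.
Qed.

Lemma merge_zero_ex (p : prepart T G) B : B \in blocks p ->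
  exists2 q, merge_zero p q &
    forall a, prep_fun q a = if a \in B then None else prep_fun p a.
Proof.
move=> pB.
have qP : partition (blocks p :\ B) (~: (zero_block p :|: B)).
  have [/eqP cp tp np] := and3P (prep_partition p).
  apply/and3P; split; last by rewrite inE negb_and np orbT.
  - rewrite setCU -cp; apply/eqP/setP => a; rewrite !inE.
    apply/bigcupP/andP => [[C /setD1P[nC pC] aC]|[/bigcupP[C pC aC] aB]].
      split; first by apply/bigcupP; exists C.
      by apply: contra nC => aB; rewrite -(mem_prep_block pC aC) (mem_prep_block pB aB).
    by exists C => //; rewrite !inE pC andbT; apply: contraNneq aB => <-.
  - exact: trivIsetD.
pose q := @Prepart T G (zero_block p :|: B, blocks p :\ B, label p) qP.
exists q; first by apply/exists_inP; exists B => //; rewrite !eqxx.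
move=> a; rewrite {1}/prep_fun !inE.
case: ifP => [/orP[za|->//]|/norP[za naB]].
  by rewrite /prep_fun za; case: ifP.
have [aC pC] := prep_cover za.
rewrite (negPf naB) (prep_fun_block pC aC); congr (Some (_, _)).
apply: (mem_prep_block _ aC).2; rewrite !inE pC andbT.
by apply: contraNneq naB => <-.
Qed.

Lemma merge_nonzero_ex (p : prepart T G) B B' g :
  B \in blocks p -> B' \in blocks p -> B != B' ->
  exists2 q, merge_nonzero p q &
    forall a, prep_fun q a =
      if a \in B then Some (B :|: B', label p a)
      else if a \in B' then Some (B :|: B', label p a * g)
      else prep_fun p a.
Proof.
move=> pB pB' nBB'.
have disjE C D a : C \in blocks p -> D \in blocks p -> a \in C -> a \in D -> C = D.
  by move=> pC pD aC aD; rewrite -(mem_prep_block pC aC) (mem_prep_block pD aD).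
have qP : partition ((B :|: B') |: (blocks p :\ B :\ B')) (~: zero_block p).
  have [/eqP cp tp np] := and3P (prep_partition p).
  apply/and3P; split.
  - rewrite -cp; apply/eqP/setP => a; apply/bigcupP/bigcupP => -[C].
      rewrite !inE => /orP[/eqP ->|/and3P[_ _ pC] aC]; last by exists C.
      by rewrite inE => /orP[] aC; [exists B|exists B'].
    move=> pC aC; have [eC|nC] := eqVneq C B.
      by exists (B :|: B'); rewrite !inE -?eC ?eqxx ?aC.
    have [eC'|nC'] := eqVneq C B'.
      by exists (B :|: B'); rewrite !inE -?eC' ?eqxx ?aC ?orbT.
    by exists C; rewrite // !inE nC nC' pC orbT.
  - apply/trivIsetP => C D.
    wlog: C D / D != B :|: B'.
      move=> H hC hD nCD; have [eD|nD] := eqVneq D (B :|: B').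
        by rewrite disjoint_sym; apply: (H D C) => //; rewrite -?eD // eq_sym.
      exact: H.
    move=> nD; rewrite !inE (negPf nD) /= => hC /and3P[nDB' nDB pD] nCD.
    apply/pred0P => a /=; apply/negP => /andP[aC aD].
    case/orP: hC => [/eqP eC|/and3P[_ _ pC]]; last first.
      by rewrite (disjE C D a) ?eqxx in nCD.
    move: aC; rewrite eC inE => /orP[] aB.
      by rewrite (disjE D B a) ?eqxx in nDB.
    by rewrite (disjE D B' a) ?eqxx in nDB'.
  - rewrite !inE (negPf np) !andbF orbF.
    apply: contra np => /eqP/setP U0.
    suff -> : set0 = B by [].
    by apply/setP => a; have := U0 a; rewrite !inE; case: (a \in B).
pose lab := [ffun a => if a \in B' then label p a * g else label p a].
pose q := @Prepart T G (zero_block p, (B :|: B') |: (blocks p :\ B :\ B'), lab) qP.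
exists q.
  apply/exists_inP; exists B => //; apply/exists_inP; exists B' => //.
  by apply/existsP; exists g; rewrite nBB' !eqxx.
have qU : B :|: B' \in blocks q by rewrite !inE eqxx.
move=> a; case: ifP => aB.
  have aU : a \in B :|: B' by rewrite inE aB.
  rewrite (prep_fun_block qU aU) /label /= ffunE ifF //.
  by apply: contraNF nBB' => aB'; rewrite (disjE B B' a).
case: ifP => aB'.
  have aU : a \in B :|: B' by rewrite inE aB' orbT.
  by rewrite (prep_fun_block qU aU) /label /= ffunE ifT.
case: (boolP (a \in zero_block p)) => za; first by rewrite /prep_fun za.
have [aC pC] := prep_cover za; set C := pblock _ a in aC pC.
have qC : C \in blocks q.
  rewrite !inE pC andbT; apply/orP; right; apply/andP.
  by split; [apply: contraFneq aB' => <-|apply: contraFneq aB => <-].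
by rewrite (prep_fun_block pC aC) (prep_fun_block qC aC) /label /= ffunE aB'.
Qed.

Lemma covers_merge (p q : prepart T G) : merge_zero p q || merge_nonzero p q ->
  dowling_covers (dowling_class p) (dowling_class q).
Proof.
move=> pq; apply/exists_inP; exists p; first exact: mem_dowling_class.
by apply/exists_inP; exists q; first exact: mem_dowling_class.
Qed.

(** If the kernel of [p] is contained in that of [q], one of three cases occurs. Some nonzero block
    of [p] meets the zero block of [q], and all of it can be merged into zero. Two blocks of [p] lie
    in one block of [q], and they can be merged with the relative label dictated by [q]. Otherwise
    the two kernels coincide. *)
Lemma kernel_le_merge (p q : prepart T G) : kernel_le (prep_fun p) (prep_fun q) ->
  dowling_class p = dowling_class q \/
  exists2 s, merge_zero p s || merge_nonzero p s & kernel_le (prep_fun s) (prep_fun q).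
Proof.
move=> [zpq kpq].
have [/exists_inP[a zpa zqa]|no1] :=
  boolP [exists a in ~: zero_block p, a \in zero_block q].
  rewrite inE in zpa; have [aB pB] := prep_cover zpa.
  set B := pblock _ a in aB pB.
  have [s ms fs] := merge_zero_ex pB; right; exists s; first by rewrite ms.
  have zB b : b \in B -> prep_fun q b = None.
    move=> bB; have /kpq -> : prep_fun p b
        = lact (label p b * (label p a)^-1) (prep_fun p a).
      by rewrite !(prep_fun_block pB) // -lact_Some.
    by rewrite /prep_fun zqa.
  split=> [b|b c g]; rewrite !fs; case: ifP => bB; try by move=> _; apply: zB.
    exact: zpq.
    case: ifP => cB; first by rewrite !zB.
    by move/esym/lact_None/zpq => e; rewrite zB // e.
  case: ifP => cB; last exact: kpq.
  by move/zpq => ->; rewrite zB.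
have zE : zero_block p = zero_block q.
  apply/setP=> a; apply/idP/idP => [/prep_fun_None/zpq/prep_fun_None//|za].
  apply: contraNT no1 => zpa.
  by apply/exists_inP; exists a; rewrite // inE.
have [/existsP[a /existsP[b /and4P[za zb nab eab]]]|no2] :=
  boolP [exists a, exists b, [&& a \notin zero_block p, b \notin zero_block p,
    pblock (blocks p) a != pblock (blocks p) b &
    pblock (blocks q) a == pblock (blocks q) b]].
  have [aB pB] := prep_cover za; have [bB' pB'] := prep_cover zb.
  set B := pblock (blocks p) a in nab aB pB.
  set B' := pblock (blocks p) b in nab bB' pB'.
  (* With this [g], the ratio of the new label of [b] to the label of [a] is
     [label q b * (label q a)^-1], as in [q]. *)
  pose g := (label p b)^-1 * label q b * (label q a)^-1 * label p a.
  have [s ms fs] := merge_nonzero_ex g pB pB' nab.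
  right; exists s; first by rewrite ms orbT.
  have q_ab : prep_fun q b = lact (label q b * (label q a)^-1) (prep_fun q a).
    by rewrite /prep_fun -zE (negPf za) (negPf zb) (eqP eab) -lact_Some.
  (* each element of B or B' sees the label of a, transported inside the
     merged block *)
  have toA c u C : prep_fun s c = Some (C, u) -> (c \in B) || (c \in B') ->
      C = B :|: B' /\ prep_fun q c = lact (u * (label p a)^-1) (prep_fun q a).
    rewrite fs; case: ifP => cB /=.
      case=> <- <- _; split=> //; apply: kpq.
      by rewrite !(prep_fun_block pB) // -lact_Some.
    move=> + cB'; rewrite cB' => -[<- <-]; split=> //.
    have /kpq -> : prep_fun p c = lact (label p c * (label p b)^-1) (prep_fun p b).
      by rewrite !(prep_fun_block pB') // -lact_Some.
    by rewrite q_ab -lactM /g !mulgA mulgK.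
  (* An untouched block of [p] cannot carry the same name as the merged block, so mixed pairs never
     share a block of [s]. *)
  have pU : B :|: B' \in blocks p -> False.
    move=> pU; have aU : a \in B :|: B' by rewrite inE aB.
    have bU : b \in B :|: B' by rewrite inE bB' orbT.
    by case/eqP: nab; rewrite /B /B' (mem_prep_block pU aU) (mem_prep_block pU bU).
  apply: kernel_leP => [c|c e C u v ec ee].
    rewrite fs; do 2![case: ifP => // _]; exact: zpq.
  case: (boolP ((c \in B) || (c \in B'))) => hc;
  case: (boolP ((e \in B) || (e \in B'))) => he.
  - rewrite (toA _ _ _ ec hc).2 (toA _ _ _ ee he).2 -lactM; congr lact.
    by rewrite mulgA mulgKV.
  - have [eC _] := toA _ _ _ ec hc; case/norP: he => /negPf he /negPf he'.
    by move: ee; rewrite fs he he' => /prep_fun_Some[]; rewrite eC => /pU.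
  - have [eC _] := toA _ _ _ ee he; case/norP: hc => /negPf hc /negPf hc'.
    by move: ec; rewrite fs hc hc' => /prep_fun_Some[]; rewrite eC => /pU.
  case/norP: he => /negPf he /negPf he'; case/norP: hc => /negPf hc /negPf hc'.
  move: ec ee; rewrite !fs hc hc' he he' => ec ee; apply: kpq.
  by rewrite ec ee -lact_Some.
left; apply/dowling_class_eq/prepart_eqv_kernel; split=> //.
apply: kernel_leP => [a /prep_fun_None|a b C u v].
  by rewrite -zE => ?; apply/prep_fun_None.
move=> ea eb; have [qC aC la] := prep_fun_Some ea.
have [_ bC lb] := prep_fun_Some eb.
have za : a \notin zero_block p by rewrite zE (mem_prep_block qC aC).
have zb : b \notin zero_block p by rewrite zE (mem_prep_block qC bC).
have e : pblock (blocks p) a = pblock (blocks p) b.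
  apply/eqP; apply: contraNT no2 => nab.
  apply/existsP; exists a; apply/existsP; exists b; rewrite za zb nab /=.
  by rewrite (mem_prep_block qC aC).2 (mem_prep_block qC bC).2.
have : prep_fun p a = lact (label p a * (label p b)^-1) (prep_fun p b).
  by rewrite /prep_fun (negPf za) (negPf zb) e -lact_Some.
move=> h; move: (kpq _ _ _ h); rewrite ea eb /= => -[->].
by rewrite mulgK.
Qed.

(** The generated order becomes inclusion of kernels. For the converse, mergings are performed one
    at a time below [q]; the number of blocks decreases, so this stops. *)
Lemma dowling_class_le (p q : prepart T G) :
  (dowling_class p <= dowling_class q)%O <-> kernel_le (prep_fun p) (prep_fun q).
Proof.
split.
  case/connectP=> s; elim: s p => [|z s IHs] p /=.
    by move=> _ /esym/dowling_class_eq/prepart_eqv_kernel[].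
  case/andP=> /exists_inP[p' pp' /exists_inP[z' zz' mz]] zs eq.
  have /dowling_class_eq/prepart_eqv_kernel[h _] := mem_dowling pp'.
  rewrite (mem_dowling zz') in zs eq.
  exact: kernel_le_trans h (kernel_le_trans (merge_kernel_le mz) (IHs _ zs eq)).
have [m] := ubnP #|blocks p|; elim: m p => // m IHm p lt_m pq.
case: (kernel_le_merge pq) => [->|[s ms sq]]; first exact: le_refl.
apply: le_trans (connect1 (covers_merge ms)) (IHm s _ sq).
by rewrite (merge_card_eq ms) in lt_m; rewrite -ltnS.
Qed.

End Kernel.

(** * Elements of the Dowling poset presented by labelled functions, and their number of blocks *)

Section Dow.
Variables (T : finType) (G : finGroupType).

Definition key J (f : T -> option (J * G)) a := omap fst (f a).

Fact prep_of_subproof (J : eqType) (f : T -> option (J * G)) :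
  partition (preim_partition (key f) (~: [set a | key f a == None]))
    (~: [set a | key f a == None]).
Proof. exact: preim_partitionP. Qed.

(** The blocks are the fibres of [key f], so the names in [J] can be arbitrary: block numbers,
    pairs, tagged sets. On the zero block the label takes the default [1], and [prepart_eqv] does
    not see it. *)
Definition prep_of (J : eqType) (f : T -> option (J * G)) : prepart T G :=
  @Prepart T G ([set a | key f a == None],
    preim_partition (key f) (~: [set a | key f a == None]),
    [ffun a => odflt 1 (omap snd (f a))]) (prep_of_subproof f).

Definition dowling_of (J : eqType) (f : T -> option (J * G)) := dowling_class (prep_of f).

Lemma zero_prep_of (J : eqType) (f : T -> option (J * G)) a :
  (a \in zero_block (prep_of f)) = (key f a == None).
Proof. by rewrite inE. Qed.

Lemma label_prep_of (J : eqType) (f : T -> option (J * G)) a j u :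
  f a = Some (j, u) -> label (prep_of f) a = u.
Proof. by move=> e; rewrite /label /= ffunE e. Qed.

Lemma block_prep_of (J : eqType) (f : T -> option (J * G)) a :
  key f a != None ->
  pblock (blocks (prep_of f)) a = [set b | key f b == key f a].
Proof.
move=> na; have za : a \in ~: [set a | key f a == None] by rewrite !inE.
apply/setP => b; rewrite inE.
have [kb|nb] := eqVneq (key f b) None.
  rewrite kb eq_sym (negPf na); apply/negP => bB.
  have : b \in cover (blocks (prep_of f)).
    rewrite /cover; apply/bigcupP; exists (pblock (blocks (prep_of f)) a) => //.
    by rewrite (prep_cover _).2 // zero_prep_of.
  by rewrite (cover_partition (prep_partition _)) in_setC zero_prep_of kb.
rewrite (@pblock_equivalence_partition _ _ (~: [set a | key f a == None])).
- by rewrite /= eq_sym.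
- by split=> // /eqP ->.
- by [].
- by rewrite !inE.
Qed.

Lemma prep_of_kernel (J : eqType) (f : T -> option (J * G)) :
  kernel_le (prep_fun (prep_of f)) f /\ kernel_le f (prep_fun (prep_of f)).
Proof.
split; apply: kernel_leP => [a|a b B u v].
- by move/prep_fun_None; rewrite zero_prep_of /key; case: (f a).
- rewrite /prep_fun !zero_prep_of; case: ifP => // /negbT na [<- <-].
  case: ifP => // /negbT nb []; rewrite !block_prep_of // => /setP/(_ a).
  rewrite !inE eqxx => /eqP kab <-; move: kab na nb; rewrite /key.
  case ea: (f a) => [[i w]|] //=; case eb: (f b) => [[j z]|] //= [->] _ _.
  by rewrite (label_prep_of ea) (label_prep_of eb) mulgKV.
- by move=> fa; apply/prep_fun_None; rewrite zero_prep_of /key fa.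
move=> ea eb; have [na nb]: key f a != None /\ key f b != None.
  by rewrite /key ea eb.
rewrite /prep_fun !zero_prep_of (negPf na) (negPf nb) !block_prep_of //.
have -> : key f a = key f b by rewrite /key ea eb.
by rewrite (label_prep_of ea) (label_prep_of eb) /= mulgKV.
Qed.

Lemma dowling_of_le (J J' : eqType) (f : T -> option (J * G)) (f' : T -> option (J' * G)) :
  (dowling_of f <= dowling_of f')%O <-> kernel_le f f'.
Proof.
have [fp pf] := prep_of_kernel f; have [fp' pf'] := prep_of_kernel f'.
split=> [/dowling_class_le h|h].
  exact: kernel_le_trans pf (kernel_le_trans h fp').
by apply/dowling_class_le; apply: kernel_le_trans fp (kernel_le_trans h pf').
Qed.

Lemma eq_dowling_of (J J' : eqType) (f : T -> option (J * G)) (f' : T -> option (J' * G)) :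
  kernel_le f f' -> kernel_le f' f -> dowling_of f = dowling_of f'.
Proof. by move=> ? ?; apply/le_anti/andP; split; apply/dowling_of_le. Qed.

Lemma eq_dowling_of_fun (J : eqType) (f f' : T -> option (J * G)) :
  f =1 f' -> dowling_of f = dowling_of f'.
Proof.
by move=> e; apply: eq_dowling_of; split=> [a|a b g]; rewrite !e.
Qed.

Implicit Types x y z : dowling T G.

Fact rep_subproof x : exists p, p \in val x.
Proof. by have [p ->] := dowlingP x; exists p; apply: mem_dowling_class. Qed.

Definition rep x := xchoose (rep_subproof x).

Lemma rep_mem x : rep x \in val x. Proof. exact: xchooseP. Qed.

(** It is attached to a chosen representative, so equalities involving it hold only up to
    [kernel_le] in both directions, as in [dowling_of_kernel]. *)
Definition dowling_fun x := prep_fun (rep x).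

Lemma dowling_funK x : dowling_of (dowling_fun x) = x.
Proof.
rewrite [RHS](mem_dowling (rep_mem x)).
by apply/dowling_class_eq/prepart_eqv_kernel/prep_of_kernel.
Qed.

Lemma dowling_of_kernel (J : eqType) (f : T -> option (J * G)) :
  kernel_le (dowling_fun (dowling_of f)) f /\ kernel_le f (dowling_fun (dowling_of f)).
Proof. by split; apply/dowling_of_le; rewrite dowling_funK. Qed.

Lemma dowling_fun_le x y : (x <= y)%O <-> kernel_le (dowling_fun x) (dowling_fun y).
Proof. by rewrite -{1}(dowling_funK x) -{1}(dowling_funK y); exact: dowling_of_le. Qed.

Definition nblocks x := #|blocks (rep x)|.

Lemma nblocks_mem x p : p \in val x -> nblocks x = #|blocks p|.
Proof. by move=> xp; rewrite /nblocks (dowling_blocks (rep_mem x) xp). Qed.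

Lemma nblocks_dowling_of (J : finType) (f : T -> option (J * G)) :
  nblocks (dowling_of f) = #|[set j | [exists a, key f a == Some j]]|.
Proof.
rewrite (nblocks_mem (mem_dowling_class _)).
pose fib j := [set b | key f b == Some j].
rewrite -(card_in_imset (f := fib)).
  apply: eq_card => B; apply/idP/imsetP => [pB|[j]].
    have /set0Pn[a aB] := partition_neq0 (prep_partition _) pB.
    have [za eB] := mem_prep_block pB aB.
    rewrite zero_prep_of in za; rewrite block_prep_of // in eB.
    case ka: (key f a) za eB => [j|//] _ <-; exists j => //.
    by rewrite inE; apply/existsP; exists a; rewrite ka.
  rewrite inE => /existsP[a /eqP ka] ->.
  have za : a \notin zero_block (prep_of f) by rewrite zero_prep_of ka.
  by have := (prep_cover za).2; rewrite block_prep_of ka.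
move=> i j; rewrite !inE => /existsP[a ka] _ /setP/(_ a).
by rewrite !inE ka (eqP ka) => /esym/eqP[].
Qed.

Lemma covers_nblocks x y : dowling_covers x y -> nblocks x = (nblocks y).+1.
Proof.
case/exists_inP=> p xp /exists_inP[q yq pq].
by rewrite (nblocks_mem xp) (nblocks_mem yq) (merge_card_eq pq).
Qed.

Lemma nblocks_le x y : (x <= y)%O -> (nblocks y <= nblocks x)%N.
Proof.
case/connectP=> s; elim: s x => [|z s IHs] x /= => [_ ->//|].
by case/andP=> /covers_nblocks -> /IHs h /h /leqW.
Qed.

(** The element [z] is the first one on a chain of mergings from [x] to [y]; this provides the step
    condition of a rank function. *)
Lemma nblocks_step x y : (x < y)%O ->
  exists z, [/\ (x < z)%O, (z <= y)%O & nblocks x = (nblocks z).+1].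
Proof.
rewrite lt_neqAle => /andP[nxy /connectP[[|z s] /=]]; first by move=> _ e; rewrite e eqxx in nxy.
case/andP=> xz zs ey; exists z; split; last exact: covers_nblocks.
  rewrite lt_neqAle; apply/andP; split; last exact: connect1.
  by apply/eqP => e; have := covers_nblocks xz; rewrite e => /n_Sn.
by apply/connectP; exists s.
Qed.

Lemma nblocks_lt x y : (x < y)%O -> (nblocks y < nblocks x)%N.
Proof. by case/nblocks_step=> z [_ zy ->]; rewrite ltnS nblocks_le. Qed.
End Dow.

(** * Graded posets and upper intervals *)

(** A relation that is total on both sides and matches the two orders is the graph of an
    isomorphism: antisymmetry makes the choices on both sides mutually inverse. *)
Lemma poset_iso_rel d d' (T : finPOrderType d) (U : finPOrderType d')
    (R : T -> U -> bool) :
  (forall x, exists u, R x u) -> (forall u, exists x, R x u) ->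
  (forall x y u v, R x u -> R y v -> (x <= y)%O = (u <= v)%O) ->
  poset_iso T U.
Proof.
move=> RT RU le_R.
pose f x := xchoose (RT x); pose g u := xchoose (RU u).
have Rf x : R x (f x) := xchooseP (RT x).
have Rg u : R (g u) u := xchooseP (RU u).
exists f; split; last by move=> x y; rewrite (le_R _ _ _ _ (Rf x) (Rf y)).
exists g; [move=> x|move=> u]; apply/le_anti.
  by rewrite (le_R _ _ _ _ (Rg _) (Rf _)) (le_R _ _ _ _ (Rf _) (Rg _)) lexx.
by rewrite -(le_R _ _ _ _ (Rg u) (Rf _)) -(le_R _ _ _ _ (Rf _) (Rg u)) lexx.
Qed.

(** * Maximal chains and rank in a finite poset with a top element and a rank function [rho] *)

Section Graded.
Variables (d : Order.disp_t) (T : finPOrderType d) (rho : T -> nat) (top : T).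
Hypothesis le_top : forall x, (x <= top)%O.
Hypothesis rho_lt : forall x y, (x < y)%O -> (rho x < rho y)%N.
Hypothesis rho_step : forall x y, (x < y)%O ->
  exists z, [/\ (x < z)%O, (z <= y)%O & rho z = (rho x).+1].
Hypothesis rho_min : forall x, (0 < rho x)%N -> exists y, (y < x)%O.

Lemma rho_le x y : (x <= y)%O -> (rho x <= rho y)%N.
Proof. by rewrite le_eqVlt => /predU1P[->//|/rho_lt/ltnW]. Qed.

Lemma chain_comparable (C : {set T}) x y : is_chain C -> x \in C -> y \in C -> (x >=< y)%O.
Proof. by move=> /forall_inP h /h /forall_inP; apply. Qed.

Lemma chain_le (C : {set T}) x y : is_chain C -> x \in C -> y \in C ->
  (x <= y)%O = (rho x <= rho y)%N.
Proof.
move=> cC xC yC; have := chain_comparable cC xC yC.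
case: (comparableP x y) => // h _; last by rewrite h leqnn.
  by rewrite (ltnW (rho_lt h)).
by apply/esym/negbTE; rewrite -ltnNge rho_lt.
Qed.

Lemma chain_inj (C : {set T}) : is_chain C -> {in C &, injective rho}.
Proof.
move=> cC x y xC yC e; apply/le_anti.
by rewrite !(chain_le cC) // e leqnn.
Qed.

Lemma max_chain_mem (C : {set T}) x : is_max_chain C ->
  (forall y, y \in C -> (x >=< y)%O) -> x \in C.
Proof.
case/maxsetP=> cC mC xC.
rewrite -(mC (x |: C)) ?setU11 ?subsetUr //.
apply/forall_inP => y /setU1P[->|yC]; apply/forall_inP => z /setU1P[->|zC].
- exact: comparablexx.
- exact: xC.
- by rewrite comparable_sym xC.
- exact: chain_comparable cC yC zC.
Qed.

(** A maximal chain misses no level. Its lowest element has level 0 by [rho_min], and any gap above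
    level [i] could be filled using [rho_step]. *)
Lemma max_chain_rho (C : {set T}) i : is_max_chain C -> (i <= rho top)%N ->
  exists2 c, c \in C & rho c = i.
Proof.
move=> mC; have cC := maxsetp mC.
have topC : top \in C.
  by apply: max_chain_mem => // y _; rewrite comparable_sym le_comparable.
elim: i => [_|i IHi lti].
  case: (@arg_minnP _ top (mem C) rho topC) => c cC' minc; exists c => //.
  apply/eqP; rewrite -leqn0 leqNgt; apply/negP => /rho_min[y ltyc].
  have yC : y \in C.
    apply: max_chain_mem => // z zC; apply: le_comparable.
    by apply: le_trans (ltW ltyc) _; rewrite (chain_le cC) // minc.
  by have := minc y yC; rewrite leqNgt rho_lt.
have [c cC' ec] := IHi (ltnW lti).
pose P := [pred b | (b \in C) && (i < rho b)%N].
have topP : P top by rewrite /= topC lti.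
case: (arg_minnP rho topP) => b /andP[bC ltib] minb.
have ltcb : (c < b)%O.
  rewrite lt_neqAle (chain_le cC) // ec (ltnW ltib) andbT.
  by apply: contraTneq ltib => <-; rewrite ec ltnn.
(* Here [b] is the lowest element of [C] above level [i], so every element of [C] is either below
   [c] or above [b]. Thus [z] is comparable with all of [C] and belongs to it by maximality. *)
have [z [ltcz lezb ez]] := rho_step ltcb.
exists z; last by rewrite ez ec.
apply: max_chain_mem => // y yC; have [leyc|ltcy] := leqP (rho y) i.
  rewrite comparable_sym; apply: le_comparable.
  by apply: le_trans (ltW ltcz); rewrite (chain_le cC) // ec.
apply: le_comparable; apply: le_trans lezb _.
by rewrite (chain_le cC) // minb //= yC.
Qed.

Lemma card_chain (C : {set T}) m : is_chain C ->
  (forall x, x \in C -> (rho x <= m)%N) -> (#|C| <= m.+1)%N.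
Proof.
move=> cC leC; rewrite -[m.+1]card_ord.
pose f (x : T) : 'I_m.+1 := inord (rho x).
rewrite -(card_in_imset (f := f)) ?max_card // => x y xC yC.
move/(congr1 val); rewrite /= !inordK ?ltnS ?leC // => e.
exact: (chain_inj cC).
Qed.

Lemma card_rho_chain (C : {set T}) m : is_max_chain C -> (m <= rho top)%N ->
  #|[set x in C | (rho x <= m)%N]| = m.+1.
Proof.
move=> mC lem; apply/eqP; rewrite eqn_leq card_chain /=; last 2 first.
- apply/forall_inP => x; rewrite inE => /andP[xC _]; apply/forall_inP => y.
  by rewrite inE => /andP[yC _]; apply: chain_comparable (maxsetp mC) xC yC.
- by move=> x; rewrite inE => /andP[].
rewrite -{1}[m.+1]card_ord.
have ex (i : 'I_m.+1) : exists x, (x \in C) && (rho x == i).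
  have [|x xC e] := @max_chain_rho C i mC; last by exists x; rewrite xC e eqxx.
  by apply: leq_trans lem; rewrite -ltnS.
pose f i := xchoose (ex i).
have fP i : (f i \in C) && (rho (f i) == i) := xchooseP (ex i).
have injf : injective f.
  move=> i j e; apply/val_inj => /=.
  by have /andP[_ /eqP <-] := fP i; have /andP[_ /eqP <-] := fP j; rewrite e.
rewrite -(card_image injf); apply/subset_leq_card/subsetP => x /imageP[i _ ->].
by have /andP[fC /eqP e] := fP i; rewrite inE fC e -ltnS ltn_ord.
Qed.

Lemma graded_max_chain (C : {set T}) : is_max_chain C -> #|C| = (rho top).+1.
Proof.
move=> mC; rewrite -(card_rho_chain mC (leqnn _)).
by apply: eq_card => x; rewrite inE rho_le // andbT.
Qed.

Lemma graded_rank x : rank x = rho x.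
Proof.
rewrite /rank; suff -> : (\max_(C : {set T} | is_chain C &&
  [forall y in C, (y <= x)%O]) #|C|)%N = (rho x).+1 by [].
apply/eqP; rewrite eqn_leq; apply/andP; split.
  apply/bigmax_leqP => C /andP[cC /forall_inP leC].
  by apply: card_chain => // y /leC/rho_le.
(* The bound is attained by a maximal chain through [x], truncated at the level of [x]. *)
have : is_chain [set x].
  apply/forall_inP => y /set1P ->; apply/forall_inP => z /set1P ->.
  exact: comparablexx.
case/maxset_exists=> C mC; rewrite sub1set => xC.
rewrite -(card_rho_chain mC (rho_le (le_top x))).
apply: (@leq_bigmax_cond _ _ (fun C : {set T} => #|C|)); apply/andP; split.
  apply/forall_inP => y; rewrite inE => /andP[yC _]; apply/forall_inP => z.
  by rewrite inE => /andP[zC _]; apply: chain_comparable (maxsetp mC) yC zC.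
apply/forall_inP => y; rewrite inE => /andP[yC].
by rewrite (chain_le (maxsetp mC)).
Qed.

Lemma graded_maximal t : is_maximal t -> t = top.
Proof. by move/forallP/(_ top); rewrite le_top => /eqP. Qed.

Lemma graded_ex_maximal : exists! t : T, is_maximal t.
Proof.
exists top; split=> [|t /graded_maximal //].
apply/forallP => y; apply/implyP => ley; apply/eqP/le_anti.
by rewrite ley le_top.
Qed.

End Graded.

(** * Pullback along labelled maps, and the intervals above an element *)

Section Pullback.
Variables (G : finGroupType).

Lemma kernel_le_key (T : finType) J J' (f : T -> option (J * G))
    (f' : T -> option (J' * G)) a b :
  kernel_le f f' -> key f a = key f b -> key f' a = key f' b.
Proof.
case=> z kk; rewrite /key; case ea: (f a) => [[i u]|]; case eb: (f b) => [[j v]|] //.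
  case=> ij; have /kk -> : f a = lact (u * v^-1) (f b) by rewrite ea eb ij -lact_Some.
  by case: (f' b).
by rewrite (z _ ea) (z _ eb).
Qed.

(** This is composition of partial labelled maps: the label coming from [phi] multiplies on the
    left, the side on which [lact] acts. *)
Definition bind (T T' : finType) J (phi : T' -> option (T * G))
    (f : T -> option (J * G)) a :=
  if phi a is Some (t, h) then lact h (f t) else None.

Lemma bind_kernel_le (T T' : finType) J J' (phi : T' -> option (T * G))
    (f : T -> option (J * G)) (f' : T -> option (J' * G)) :
  kernel_le f f' -> kernel_le (bind phi f) (bind phi f').
Proof.
move=> [z kk]; rewrite /bind; split=> [a|a b g].
  by case: (phi a) => // -[t h] /lact_None/z ->.
case: (phi a) (phi b) => [[t h]|] [[t' h']|] //=.
- by rewrite -lactM => /lact_canl; rewrite -lactM => /kk ->; rewrite -!lactM mulVKg.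
- by move/lact_None/z ->.
by rewrite -lactM => /esym/lact_None/z ->.
Qed.

Lemma bind_lact (T T' : finType) J (phi : T' -> option (T * G))
    (f : T -> option (J * G)) a b g :
  phi a = lact g (phi b) -> bind phi f a = lact g (bind phi f b).
Proof.
rewrite /bind => ->; case: (phi b) => [[t h]|] //=; exact: lactM.
Qed.

Lemma bind_ge (T T' : finType) J (phi : T' -> option (T * G))
    (f : T -> option (J * G)) : kernel_le phi (bind phi f).
Proof. by split=> [a|a b g]; [rewrite /bind => -> | apply: bind_lact]. Qed.

Definition pullback (T T' : finType) (phi : T' -> option (T * G)) z :=
  dowling_of (bind phi (dowling_fun z)).

Lemma pullback_le (T T' : finType) (phi : T' -> option (T * G)) z z' :
  (z <= z')%O -> (pullback phi z <= pullback phi z')%O.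
Proof. by move=> zz'; apply/dowling_of_le/bind_kernel_le/dowling_fun_le. Qed.

Lemma pullback_dowling_of (T T' : finType) (J : eqType) (phi : T' -> option (T * G))
    (f : T -> option (J * G)) : pullback phi (dowling_of f) = dowling_of (bind phi f).
Proof.
by have [h1 h2] := dowling_of_kernel f; apply: eq_dowling_of; apply: bind_kernel_le.
Qed.

Section Upper.
Variables (T : finType) (x : dowling T G).
Let l := nblocks x.

(** The map [phi] is the quotient of [T] onto the numbered nonzero blocks of [x], and [s] picks an
    element in each block. The labels of a block are divided on the right by that of its chosen
    element, which thus gets label [1]. *)
Lemma section_ex : exists (phi : T -> option ('I_l * G)) (s : 'I_l -> T),
  x = dowling_of phi /\ forall i, phi (s i) = Some (i, 1).
Proof.
pose p := rep x.
have ne (i : 'I_l) : exists a, a \in enum_val i.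
  apply/set0Pn; exact: partition_neq0 (prep_partition p) (enum_valP i).
pose s i := xchoose (ne i); have sP i : s i \in enum_val i := xchooseP (ne i).
pose phi a := if [pick i : 'I_l | a \in enum_val i] is Some i
              then Some (i, label p a * (label p (s i))^-1) else None.
have blkE (i : 'I_l) a : a \in enum_val i ->
    phi a = Some (i, label p a * (label p (s i))^-1).
  move=> ai; rewrite /phi; case: pickP => [j aj|/(_ i)]; last by rewrite ai.
  suff -> : i = j by [].
  apply: enum_val_inj; rewrite -(mem_prep_block (enum_valP i) ai).2.
  by rewrite (mem_prep_block (enum_valP j) aj).2.
exists phi, s; split; last by move=> i; rewrite (blkE i) // mulgV.
have xE a : dowling_fun x a = if phi a is Some (i, w)
    then Some (enum_val i, w * label p (s i)) else None.
  rewrite /phi; case: pickP => [i ai|none].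
    by rewrite mulgKV; apply: prep_fun_block (enum_valP i) ai.
  apply/prep_fun_None; case: (boolP (a \in _)) => // za.
  have [aB pB] := prep_cover za.
  by have := none (enum_rank_in pB (pblock (blocks p) a)); rewrite /= enum_rankK_in ?aB.
rewrite -[LHS]dowling_funK; apply: eq_dowling_of; apply: kernel_leP => [a|a b].
- by rewrite xE; case: (phi a) => // -[].
- move=> j u v; rewrite !xE.
  case: (phi a) (phi b) => [[i w]|] [[i' w']|] // [<- <-] [/enum_val_inj <- <-].
  by rewrite /= invMg !mulgA !mulgK mulgKV.
- by rewrite xE => ->.
move=> j u v ea eb; rewrite !xE ea eb /=.
by rewrite mulgA mulgKV.
Qed.

Variables (phi : T -> option ('I_l * G)) (s : 'I_l -> T).
Hypotheses (xphi : x = dowling_of phi) (phis : forall i, phi (s i) = Some (i, 1)).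

Let sec i : option (T * G) := Some (s i, 1).

(** Above [x], the ratios inside a block of [x] are already fixed, so [z] is determined by its
    values at the chosen elements [s i]. *)
Lemma sec_le z a : (x <= z)%O -> bind phi (bind sec (dowling_fun z)) a = dowling_fun z a.
Proof.
rewrite -{1}(dowling_funK z) xphi => /dowling_of_le[zz kk].
rewrite /bind /sec; case ea: (phi a) => [[i h]|]; last by rewrite zz.
rewrite lact1; apply/esym/kk; by rewrite phis ea /= mulg1.
Qed.

(** Pulling back along [phi] and along the section [sec] are monotone and mutually inverse between
    the Dowling poset on the blocks of [x] and the elements above [x]. The embedding [w] allows for
    intervals that live inside nested subposets. *)
Lemma upper_poset_iso (U : finPOrderType poset_display) (w : U -> dowling T G) :
  {mono w : u v / (u <= v)%O >-> (u <= v)%O} -> (forall u, (x <= w u)%O) ->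
  (forall z, (x <= z)%O -> exists u, w u = z) ->
  poset_iso U (dowling 'I_l G).
Proof.
move=> wmono xw wsurj.
have secK z : (x <= z)%O -> pullback phi (pullback sec z) = z.
  move=> xz; rewrite pullback_dowling_of -[RHS]dowling_funK; apply: eq_dowling_of_fun => a.
  exact: sec_le.
have secK' y : pullback sec (pullback phi y) = y.
  rewrite pullback_dowling_of -[RHS]dowling_funK; apply: eq_dowling_of_fun => i.
  by rewrite /bind /= phis !lact1.
apply: (@poset_iso_rel _ _ _ _ (fun u y => pullback sec (w u) == y)).
- by move=> u; exists (pullback sec (w u)).
- move=> y; have [|u wu] := wsurj (pullback phi y).
    by rewrite xphi; apply/dowling_of_le/bind_ge.
  by exists u; rewrite wu secK'.
move=> u v _ _ /eqP <- /eqP <-; rewrite -wmono; apply/idP/idP.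
  exact: pullback_le.
by move/(pullback_le phi); rewrite !secK.
Qed.

Variables (lam : T -> G).
Let c := dowling_of (fun a => Some (tt, lam a)).
Hypothesis xc : (x <= c)%O.

Lemma below_Some z a : (z <= c)%O -> dowling_fun z a != None.
Proof. by rewrite -{1}(dowling_funK z) => /dowling_of_le[h _]; apply/eqP => /h. Qed.

Lemma below_lam z a b g : (z <= c)%O -> dowling_fun z a = lact g (dowling_fun z b) ->
  lam a = g * lam b.
Proof.
rewrite -{1}(dowling_funK z) => /dowling_of_le[_ h] /h [->] //.
Qed.

(** Below [c] there is no zero block and all ratios of labels are those of [lam], so only the
    underlying partitions remain to be compared. *)
Lemma below_le z z' : (z <= c)%O -> (z' <= c)%O ->
  (z <= z')%O <-> (forall a b, key (dowling_fun z) a = key (dowling_fun z) b ->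
                               key (dowling_fun z') a = key (dowling_fun z') b).
Proof.
move=> zc z'c; split.
  by move/dowling_fun_le => kk a b; apply: kernel_le_key.
move=> kk; apply/dowling_fun_le/kernel_leP => [a /eqP|a b j u v ea eb].
  by rewrite (negPf (below_Some a zc)).
have lz : lam a = u * v^-1 * lam b.
  by apply: (below_lam zc); rewrite ea eb -lact_Some.
have := kk a b; rewrite {1 2}/key ea eb => /(_ erefl); rewrite /key.
case ea': (dowling_fun z' a) (below_Some a z'c) => [[i' u']|] // _.
case eb': (dowling_fun z' b) (below_Some b z'c) => [[j' v']|] //= _ [ij'].
have : lam a = u' * v'^-1 * lam b.
  by apply: (below_lam z'c); rewrite ea' eb' ij' -lact_Some.
by rewrite lz ij' => /mulIg ->; rewrite mulgKV.
Qed.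

Lemma key_sec z a i h : (x <= z)%O -> phi a = Some (i, h) ->
  key (dowling_fun z) a = key (dowling_fun z) (s i).
Proof.
move=> xz ea; rewrite /key -(sec_le a xz) /bind ea /sec lact1.
by case: (dowling_fun z (s i)) => // -[].
Qed.

Lemma pi_pblock (m : nat) (P : 'Pi_m) i :
  (i \in pblock (val P) i) * (pblock (val P) i \in val P).
Proof.
have ci : i \in cover (val P) by rewrite (cover_partition (valP P)) inE.
by rewrite mem_pblock ci pblock_mem.
Qed.

Lemma pi_le (m : nat) (P Q : 'Pi_m) : (P <= Q)%O <->
  forall i j, pblock (val P) i = pblock (val P) j ->
              pblock (val Q) i = pblock (val Q) j.
Proof.
have tP (R : 'Pi_m) := partition_trivIset (valP R).
split=> [/forall_inP PQ i j eij|PQ].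
  have /exists_inP[C QC /subsetP sC] := PQ _ (pi_pblock P i).2.
  rewrite (def_pblock (tP Q) QC (sC _ (pi_pblock P i).1)).
  by rewrite (def_pblock (tP Q) QC (sC j _)) // eij (pi_pblock P j).1.
apply/forall_inP => B PB; have /set0Pn[i iB] := partition_neq0 (valP P) PB.
apply/exists_inP; exists (pblock (val Q) i); first exact: (pi_pblock Q i).2.
apply/subsetP => j jB; rewrite (PQ i j) ?(pi_pblock Q j) //.
by rewrite !(def_pblock (tP P) PB).
Qed.

(** Since labels are forced below [c], an element between [x] and [c] amounts to a partition of the
    set of blocks of [x]; it is related to the partition telling which of the chosen elements [s i]
    it puts together. *)
Lemma upper_pi_iso (U : finPOrderType poset_display) (w : U -> dowling T G) :
  {mono w : u v / (u <= v)%O >-> (u <= v)%O} ->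
  (forall u, (x <= w u <= c)%O) ->
  (forall z, (x <= z <= c)%O -> exists u, w u = z) ->
  poset_iso U 'Pi_l.
Proof.
move=> wmono xwc wsurj.
have xw u : (x <= w u)%O by case/andP: (xwc u).
have wc u : (w u <= c)%O by case/andP: (xwc u).
have phi_Some a : exists i h, phi a = Some (i, h).
  case ea: (phi a) => [[i h]|]; first by exists i, h.
  by move: xc; rewrite xphi => /dowling_of_le[/(_ _ ea)].
apply: (@poset_iso_rel _ _ U 'Pi_l (fun u P => [forall i, forall j,
  (pblock (val P) i == pblock (val P) j)
    == (key (dowling_fun (w u)) (s i) == key (dowling_fun (w u)) (s j))])).
- move=> u; pose k i := key (dowling_fun (w u)) (s i).
  have pP := preim_partitionP k setT.
  exists (exist (fun P => is_true (partition P setT)) _ pP).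
  apply/forallP => i; apply/forallP => j /=.
  rewrite eq_pblock ?(partition_trivIset pP) ?(cover_partition pP) ?inE //.
  by rewrite pblock_equivalence_partition ?inE //; split=> // /eqP ->.
(* Conversely, a partition [P] of the blocks is realised by joining blocks according to [P] and
   keeping the labels [lam]. *)
- move=> P; pose f a := if phi a is Some (i, _) then Some (pblock (val P) i, lam a) else None.
  have xf : kernel_le phi f.
    split=> [a|a b g]; rewrite /f; first by move->.
    move=> ab; have := ab; have [j [v eb]] := phi_Some b; rewrite eb /= => ea.
    rewrite ea /=; congr (Some (_, _)).
    by move: xc; rewrite xphi => /dowling_of_le[_ /(_ _ _ _ ab)] [->].
  have fc : kernel_le f (fun a => Some (tt, lam a)).
    apply: kernel_leP => [a|a b B u v]; rewrite /f.
      by have [i [h ->]] := phi_Some a.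
    have [i [h ->]] := phi_Some a; have [j [v' ->]] := phi_Some b.
    by move=> [_ <-] [_ <-]; rewrite -lact_Some.
  have [|u wu] := wsurj (dowling_of f).
    by rewrite {1}xphi; apply/andP; split; apply/dowling_of_le.
  exists u; apply/forallP => i; apply/forallP => j.
  have -> : (key (dowling_fun (w u)) (s i) == key (dowling_fun (w u)) (s j))
            = (key f (s i) == key f (s j)).
    rewrite wu; have [h1 h2] := dowling_of_kernel f.
    by apply/eqP/eqP; apply: kernel_le_key.
  by rewrite /key /f !phis /= (inj_eq (@Some_inj _)).
move=> u v P Q /forallP uP /forallP vQ; rewrite -wmono; apply/idP/idP.
  move/(below_le (wc u) (wc v)) => kk; apply/pi_le => i j /eqP.
  rewrite (eqP (forallP (uP i) j)) => /eqP/kk e; apply/eqP.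
  by rewrite (eqP (forallP (vQ i) j)) e.
move/pi_le => PQ; apply/(below_le (wc u) (wc v)) => a b.
have [i [h ea]] := phi_Some a; have [j [h' eb]] := phi_Some b.
rewrite !(key_sec (xw _) ea) !(key_sec (xw _) eb) => e; apply/eqP.
rewrite -(eqP (forallP (vQ i) j)); apply/eqP/PQ/eqP.
by rewrite (eqP (forallP (uP i) j)) e.
Qed.
End Upper.
End Pullback.

(** * Even elements *)

Lemma card_fibres (A C : finType) (P : pred A) (f : A -> C) :
  #|[set a | P a]| = (\sum_c #|[set a | P a && (f a == c)]|)%N.
Proof.
rewrite -sum1_card (partition_big f predT) //=; apply: eq_bigr => c _.
by rewrite -sum1_card; apply: eq_bigl => a; rewrite !inE.
Qed.

(** Over each value, the elements of the two fibres are matched according to their positions in the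
    enumerations. *)
Lemma fibre_bij (A B C : finType) (f : A -> C) (g : B -> C) :
  (forall c, #|[set a | f a == c]| = #|[set b | g b == c]|) ->
  exists2 phi : A -> B, bijective phi & forall a, g (phi a) = f a.
Proof.
move=> fg; have eqAB : #|A| = #|B|.
  rewrite -cardsT -[RHS]cardsT (card_fibres predT f) (card_fibres predT g).
  by apply: eq_bigr => c _; apply: fg.
(* The function [nth] requires a default element of [B]; when [B] is empty, so is [A]. *)
have [b0 _|B0] := pickP (@predT B); last first.
  have A0 (a : A) : False.
    have : (0 < #|A|)%N by apply/card_gt0P; exists a.
    by rewrite eqAB (eq_card0 B0).
  exists (fun a => match A0 a with end); last by move=> a; case: (A0 a).
  by apply: inj_card_bij => [a|]; [case: (A0 a)|rewrite eqAB].
pose phi a := nth b0 (enum [set b | g b == f a]) (index a (enum [set a' | f a' == f a])).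
have lt a : (index a (enum [set a' | f a' == f a]) < size (enum [set b | g b == f a]))%N.
  by rewrite -cardE -fg cardE index_mem mem_enum inE.
have gphi a : g (phi a) = f a.
  by have := mem_nth b0 (lt a); rewrite mem_enum inE => /eqP.
exists phi => //; apply: inj_card_bij => [a a' e|]; last by rewrite eqAB.
have ff : f a = f a' by rewrite -!gphi e.
move: e (lt a); rewrite /phi ff => /eqP e lt'.
rewrite nth_uniq ?enum_uniq ?lt // in e.
by move/eqP/index_inj: e; rewrite !mem_enum !inE ff eqxx => ->.
Qed.

Section Even.
Variables (G H : finGroupType) (pi : G -> H) (q : nat).
Hypothesis piM : {morph pi : x y / x * y}.

Definition proj J (o : option (J * G)) := omap (fun z => (z.1, pi z.2)) o.

Definition class_size (T : finType) (J : eqType) (f : T -> option (J * G)) j h :=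
  #|[set a | proj (f a) == Some (j, h)]|.

(* Here [H] has order [k] and [q = d / k]: as the [k] classes of a block have
   the same size, [q] divides it iff [d] divides the size of the block. *)
Definition evenf (T : finType) (J : eqType) (f : T -> option (J * G)) :=
  forall j h, class_size f j h = class_size f j 1%g /\ q %| class_size f j 1%g.

Lemma piV x : pi x^-1 = (pi x)^-1.
Proof.
have p1 : pi 1 = 1 by apply: (mulgI (pi 1)); rewrite -piM !mulg1.
by apply: (mulgI (pi x)); rewrite -piM !mulgV.
Qed.

(** A block of [f'] is a union of blocks of [f]. On each of these the labels of [f'] and [f] differ
    by a fixed right factor, which only permutes the classes; the class counts of [f'] are then sums
    of even counts. The zero block of [f] contributes nothing. *)
Lemma evenf_kernel_le (T J : finType) (J' : eqType) (f : T -> option (J * G))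
  (f' : T -> option (J' * G)) : kernel_le f f' -> evenf f -> evenf f'.
Proof.
move=> [zz kk] ev i h.
pose e h' o := #|[set a | (proj (f' a) == Some (i, h')) && (key f a == o)]|.
have cntE h' : class_size f' i h' = (\sum_o e h' o)%N by apply: card_fibres.
suff eP o : e h o = e 1 o /\ q %| e 1 o.
  rewrite !cntE; split; first by apply: eq_bigr => o _; case: (eP o).
  by apply: dvdn_sum => o _; case: (eP o).
have [a0 /= /andP[]|none] := pickP (fun a => (omap fst (f' a) == Some i) && (key f a == o)).
  case ea': (f' a0) => [[i' u']|] //= /eqP[ei]; rewrite {i'}ei in ea'.
  case: o => [j|]; last first.
    by rewrite /key; case ea: (f a0) => //; rewrite (zz _ ea) in ea'.
  rewrite /key; case ea: (f a0) => [[j' u]|] //= /eqP[ej]; rewrite {j'}ej in ea.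
  have eE h' : e h' (Some j) = class_size f j (h' * (pi (u^-1 * u'))^-1).
    apply: eq_card => a; rewrite !inE /key; case eaa: (f a) => [[j' w]|]; last first.
      by rewrite andbF.
    rewrite /proj /= (inj_eq (@Some_inj _)) (inj_eq (@Some_inj _)) xpair_eqE andbC.
    have [ej|//] := eqVneq j' j; rewrite ej in eaa; rewrite /=.
    have /kk -> : f a = lact (w * u^-1) (f a0) by rewrite eaa ea -lact_Some.
    rewrite ea' /= (inj_eq (@Some_inj _)) xpair_eqE eqxx /= -mulgA piM.
    by rewrite (can2_eq (mulgK _) (mulgKV _)).
  rewrite !eE; have [-> dv] := ev j (h * (pi (u^-1 * u'))^-1).
  by have [-> _] := ev j (1 * (pi (u^-1 * u'))^-1).
suff e0 h' : e h' o = 0%N by rewrite !e0.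
apply: eq_card0 => a; rewrite !inE; have := none a.
case: (f' a) => [[i' u]|] //=; rewrite (inj_eq (@Some_inj _)) (inj_eq (@Some_inj _)) xpair_eqE.
by case: (i' == i) => //= ->; rewrite andbF.
Qed.

Definition evend (T : finType) (x : dowling T G) := evenf (dowling_fun x).

Lemma evend_dowling_of (T J : finType) (f : T -> option (J * G)) :
  evend (dowling_of f) <-> evenf f.
Proof. by have [h1 h2] := dowling_of_kernel f; split; apply: evenf_kernel_le. Qed.

Lemma evend_le (T : finType) (x y : dowling T G) : (x <= y)%O -> evend x -> evend y.
Proof. by move/dowling_fun_le; apply: evenf_kernel_le. Qed.

Section Count.
Variables (T J : finType) (f : T -> option (J * G)).
Hypothesis ev : evenf f.

Lemma key_size j : #|[set a | key f a == Some j]| = (#|H| * class_size f j 1%g)%N.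
Proof.
rewrite (card_fibres _ (fun a => pi (odflt 1 (omap snd (f a))))).
rewrite -sum_nat_const; apply: eq_bigr => h _.
rewrite -(ev j h).1; apply: eq_card => a; rewrite !inE /key.
by case: (f a) => [[i u]|]; rewrite //= !(inj_eq (@Some_inj _)) xpair_eqE.
Qed.

Lemma class_size_gt0 j : (0 < class_size f j 1%g)%N = [exists a, key f a == Some j].
Proof.
have H0 : (0 < #|H|)%N by apply/card_gt0P; exists 1.
transitivity (0 < #|[set a | key f a == Some j]|)%N.
  by rewrite key_size muln_gt0 H0.
apply/card_gt0P/existsP => -[a]; rewrite ?inE => h; exists a => //.
by rewrite inE.
Qed.

Lemma card_ground :
  #|T| = (#|[set a | f a == None]| + #|H| * \sum_j class_size f j 1%g)%N.
Proof.
rewrite -cardsT (card_fibres predT (key f)) (bigD1 None) //=; congr (_ + _)%N.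
  by apply: eq_card => a; rewrite !inE /key; case: (f a).
rewrite big_distrr /= (reindex_omap Some id) => [|[]//].
by apply: eq_big => [j|j _]; rewrite ?eqxx // key_size.
Qed.

Lemma nblocks_class_size : nblocks (dowling_of f) = #|[set j | 0 < class_size f j 1%g]|%N.
Proof. by rewrite nblocks_dowling_of; apply: eq_card => j; rewrite !inE class_size_gt0. Qed.

Lemma sum_class_size_ge : (q * nblocks (dowling_of f) <= \sum_j class_size f j 1%g)%N.
Proof.
rewrite nblocks_class_size mulnC -sum_nat_const (big_mkcond (fun j => j \in _)).
apply: leq_sum => j _; rewrite inE; case: ifP => // c0.
by apply: dvdn_leq c0 _; case: (ev j 1).
Qed.

Lemma sum_class_size_le : (forall j, class_size f j 1%g <= q)%N ->
  (\sum_j class_size f j 1%g <= q * nblocks (dowling_of f))%N.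
Proof.
move=> le_q; rewrite nblocks_class_size mulnC -sum_nat_const [leqRHS]big_mkcond.
by apply: leq_sum => j _; rewrite inE; case: posnP => [->|].
Qed.
End Count.

Lemma card_nblocks (T : finType) (x : dowling T G) : evend x ->
  (#|H| * q * nblocks x <= #|T|)%N.
Proof.
move=> ev; rewrite (card_ground ev) -{1}(dowling_funK x) -mulnA.
by apply: leq_trans (leq_addl _ _); rewrite leq_mul2l sum_class_size_ge ?orbT.
Qed.

Lemma subset_card (T : finType) (A : {set T}) m : (m <= #|A|)%N ->
  exists2 B : {set T}, B \subset A & #|B| = m.
Proof.
move=> le_m; exists [set a in take m (enum A)].
  by apply/subsetP => a; rewrite inE => /mem_take; rewrite mem_enum.
by rewrite cardsE (card_uniqP _) ?take_uniq ?enum_uniq // size_takel -?cardE.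
Qed.

Hypotheses (pi_surj : forall h, exists g, pi g = h) (q_gt0 : (0 < q)%N).

(** A subset with exactly [q] labels in each class is cut out of the block [j]. What remains still
    has equal classes of size divisible by [q], and it is nonempty because the classes were larger
    than [q]. *)
Lemma split_block (T : finType) (x : dowling T G) j : evend x ->
  (q < class_size (dowling_fun x) j 1%g)%N -> exists2 y, (y < x)%O & evend y.
Proof.
set f := dowling_fun x => ev lt_q.
have ex h : exists B : {set T}, (B \subset [set a | proj (f a) == Some (j, h)]) && (#|B| == q).
  have [|B sB cB] := @subset_card _ [set a | proj (f a) == Some (j, h)] q.
    by rewrite -[X in (_ <= X)%N]/(class_size f j h) (ev j h).1 ltnW.
  by exists B; rewrite sB cB eqxx.
pose S h := xchoose (ex h).
have SP h : (S h \subset [set a | proj (f a) == Some (j, h)]) && (#|S h| == q)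
  := xchooseP (ex h).
have [B inB] : exists B : {set T}, forall a, (a \in B) = [exists h, a \in S h].
  by exists [set a | [exists h, a \in S h]] => a; rewrite inE.
have SE h a : (proj (f a) == Some (j, h)) && (a \in B) = (a \in S h).
  have [/subsetP sS _] := andP (SP h).
  apply/andP/idP => [[/eqP pa]|aS]; last first.
    have := sS _ aS; rewrite inE => ->; split=> //.
    by rewrite inB; apply/existsP; exists h.
  rewrite inB => /existsP[h' aS']; have [/subsetP sS' _] := andP (SP h').
  by have := sS' _ aS'; rewrite inE pa => /eqP[->].
(* Membership in [B] is added to the block names. As [B] lies inside block [j], all other blocks
   stay whole. *)
pose g a := omap (fun z => ((z.1, a \in B), z.2)) (f a).
have gf : kernel_le g f.
  apply: kernel_leP => [a|a b [i c] u v]; rewrite /g; first by case: (f a).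
  case ea: (f a) => [[i' u']|] //= [ei _ <-]; case eb: (f b) => [[i'' v']|] //= [ei' _ <-].
  by rewrite ei ei' mulgKV.
have BE i h b : class_size g (i, b) h
    = #|[set a | (proj (f a) == Some (i, h)) && ((a \in B) == b)]|.
  apply: eq_card => a; rewrite !inE /g; case: (f a) => [[i' u]|] //=.
  by rewrite !(inj_eq (@Some_inj _)) !xpair_eqE andbAC.
have BT h : class_size g (j, true) h = q.
  by rewrite BE; have [_ /eqP <-] := andP (SP h); apply: eq_card => a; rewrite inE eqb_id SE.
have cntD i h : class_size f i h = (class_size g (i, true) h + class_size g (i, false) h)%N.
  by rewrite !BE /class_size (card_fibres _ (fun a => a \in B)) big_bool.
have BTn i h : i != j -> class_size g (i, true) h = 0%N.
  move=> nij; rewrite BE; apply: eq_card0 => a; rewrite !inE eqb_id.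
  apply/negP => /andP[/eqP pa aB]; move: (aB); rewrite inB => /existsP[h' aS].
  have [/subsetP sS _] := andP (SP h'); have := sS _ aS; rewrite inE pa => /eqP[e].
  by rewrite e eqxx in nij.
exists (dowling_of g); last first.
  apply/evend_dowling_of => -[i b] h; have [e1 e2] := ev i h.
  have [eij|nij] := eqVneq i j.
    case: b; first by rewrite eij !BT dvdnn.
    rewrite !cntD eij !BT in e1 e2; rewrite eij; split; first exact: (addnI e1).
    by rewrite -(dvdn_addr _ (dvdnn q)).
  case: b; first by rewrite !BTn.
  by rewrite !cntD !BTn in e1 e2.
rewrite lt_leAnge; apply/andP; split; first by rewrite -(dowling_funK x); apply/dowling_of_le.
apply/negP; rewrite -{1}(dowling_funK x) => /dowling_of_le fg.
have /card_gt0P[a] : (0 < class_size g (j, true) 1%g)%N by rewrite BT.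
have /card_gt0P[b] : (0 < class_size g (j, false) 1%g)%N.
  by move: lt_q; rewrite cntD BT -{1}(addn0 q) ltn_add2l.
rewrite !inE /g; case eb: (f b) => [[i u]|] //= /eqP[ei eB _].
case ea: (f a) => [[i' u']|] //= /eqP[ei' eB' _].
have := kernel_le_key (a := a) (b := b) fg.
rewrite /key /g -/f ea eb ei ei' /= eB eB' => /(_ erefl).
by [].
Qed.

(** From the zero block, [#|H| * q] elements are taken to form a new block, labelled so that each
    class occurs [q] times. *)
Lemma split_zero (T : finType) (x : dowling T G) : evend x ->
  (#|H| * q <= #|[set a | dowling_fun x a == None]|)%N -> exists2 y, (y < x)%O & evend y.
Proof.
set f := dowling_fun x => ev /subset_card[D sD cD].
have zD a : a \in D -> f a = None by move/(subsetP sD); rewrite inE => /eqP.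
(* With constant maps to [unit], [fibre_bij] gives a bijection between two sets of equal size; the
   second coordinate of [psi] prescribes the class of the label. *)
have [|psi [psi' psiK psi'K] _] := @fibre_bij {a | a \in D} ('I_q * H)%type unit
    (fun=> tt) (fun=> tt).
  move=> []; rewrite -[LHS]/(#|[set a : {a | a \in D} | true]|).
  have -> : [set a : {a | a \in D} | tt == tt] = setT by apply/setP => a; rewrite !inE.
  have -> : [set a : 'I_q * H | tt == tt] = setT by apply/setP => a; rewrite !inE.
  by rewrite !cardsT card_sig card_prod card_ord mulnC -cD.
have [t tK] := fin_all_exists pi_surj.
pose lam a := if insub a is Some s then t (psi s).2 else 1.
have lamE (s : {a | a \in D}) : lam (val s) = t (psi s).2 by rewrite /lam valK.
(* The new block is named [None] and each old block [j] becomes [Some j]. *)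
pose g a := if a \in D then Some (None, lam a) else omap (fun z => (Some z.1, z.2)) (f a).
have gf : kernel_le g f.
  apply: kernel_leP => [a|a b i u v]; rewrite /g; first by case: ifP => // _; case: (f a).
  case: ifP => aD; case: ifP => bD; first by rewrite (zD a aD) (zD b bD).
  - by move=> [<- _]; case: (f b) => // -[].
  - by move=> ea [ei _]; move: ea; rewrite -ei; case: (f a) => // -[].
  case: (f a) => [[j u']|] //= [<- <-]; case: (f b) => [[j' v']|] //= [-> <-].
  by rewrite mulgKV.
have cS j h : class_size g (Some j) h = class_size f j h.
  apply: eq_card => a; rewrite !inE /g; case: ifP => aD; first by rewrite zD.
  by case: (f a) => [[i u]|] //=.
have cN h : class_size g None h = q.
  pose im (i : 'I_q) := val (psi' (i, h)).
  have inj : injective im.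
    by move=> i i' /val_inj/(can_inj psi'K)[].
  rewrite -[RHS]card_ord -cardsT -(card_imset _ inj); apply: eq_card => a.
  rewrite inE /g; apply/eqP/imsetP => [|[i _ ->]]; last first.
    by rewrite (valP (psi' (i, h))) /= lamE psi'K tK.
  case: ifP => [aD|_]; last by case: (f a).
  case=> e; exists (psi (exist _ a aD)).1; first by [].
  by rewrite /im -e -[a]/(val (exist (fun a => a \in D) a aD)) lamE tK -surjective_pairing psiK.
exists (dowling_of g); last first.
  by apply/evend_dowling_of => -[j|] h; rewrite ?cS ?cN //; exact: (ev j h).
rewrite lt_leAnge; apply/andP; split; first by rewrite -(dowling_funK x); apply/dowling_of_le.
apply/negP; rewrite -{1}(dowling_funK x) => /dowling_of_le[zz _].
have /card_gt0P[a aD] : (0 < #|D|)%N.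
  by rewrite cD muln_gt0 q_gt0 andbT; apply/card_gt0P; exists 1.
by have := zz a (zD a aD); rewrite /g aD.
Qed.

(** If no class exceeds [q], the nonzero blocks cover at most [#|H| * q] elements each, and the
    excess of [#|T|] forces at least that many into the zero block. *)
Lemma split_even (T : finType) (x : dowling T G) : evend x ->
  (#|H| * q * (nblocks x).+1 <= #|T|)%N -> exists2 y, (y < x)%O & evend y.
Proof.
move=> ev; have [j lt_q _|small] := pickP (fun j => q < class_size (dowling_fun x) j 1%g)%N.
  exact: split_block ev lt_q.
rewrite (card_ground ev) mulnS -{1}(dowling_funK x) -mulnA => le_T.
apply: split_zero => //; rewrite -(leq_add2r (#|H| * (q * nblocks (dowling_of (dowling_fun x))))).
apply: leq_trans le_T _; rewrite leq_add2l leq_mul2l sum_class_size_le ?orbT // => j.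
by rewrite leqNgt small.
Qed.
End Even.

(** * Lower ideals *)

Section Glue.
Variables (G H : finGroupType) (pi : G -> H) (q : nat).
Hypothesis piM : {morph pi : x y / x * y}.
Variables (T O : finType) (F : O -> finType).
Local Notation D := {o : O & F o}.
Variables (s : D -> T) (s' : T -> D) (tw : D -> G).
Hypotheses (sK : cancel s s') (s'K : cancel s' s) (pi_tw : forall z, pi (tw z) = 1).

(** The twist [tw] corrects labels that agree with those of a model only after applying [pi]. Its
    values are in the kernel of [pi], so it does not affect evenness. *)
Definition emb o (u : F o) : option (T * G) :=
  Some (s (Tagged F u), tw (Tagged F u)).

Definition restr o (y : dowling T G) : dowling (F o) G := pullback (@emb o) y.

Section Gluef.
Variables (J : O -> eqType).

Definition sumf (fs : forall o, F o -> option (J o * G)) (z : D) :=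
  omap (fun kg => (Tagged J kg.1, (tw z)^-1 * kg.2)) (fs (tag z) (tagged z)).

Definition gluef (fs : forall o, F o -> option (J o * G)) a := sumf fs (s' a).

End Gluef.

Lemma gluef_kernel_le (J J' : O -> eqType) (fs : forall o, F o -> option (J o * G))
    (fs' : forall o, F o -> option (J' o * G)) :
  (forall o, kernel_le (fs o) (fs' o)) -> kernel_le (gluef fs) (gluef fs').
Proof.
move=> le_fs; apply: kernel_leP => [a|a b t u v]; rewrite /gluef /sumf.
  case: (s' a) => o c /=; case e: (fs o c) => //= _.
  by rewrite (le_fs o).1.
case: (s' a) => o c; case: (s' b) => o' c' /=.
case ec: (fs o c) => [[k g]|] //= [et <-].
case ec': (fs o' c') => [[k' g']|] //= [et' <-].
have ek : Tagged J k' = Tagged J k by rewrite et et'.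
have eo : o' = o := congr1 tag ek; subst o'.
move/eqP: ek; rewrite eq_Tagged /= => /eqP ek.
rewrite {}ek in ec'.
have -> : fs' o c = lact (g * g'^-1) (fs' o c').
  by apply: (le_fs o).2; rewrite ec ec' -lact_Some.
by case: (fs' o c') => //= -[k'' w]; rewrite /= invMg invgK !mulgA mulgK.
Qed.

Definition glue (Y : forall o, dowling (F o) G) : dowling T G :=
  dowling_of (gluef (fun o => dowling_fun (Y o))).

Lemma glue_le (Y Y' : forall o, dowling (F o) G) :
  (forall o, (Y o <= Y' o)%O) -> (glue Y <= glue Y')%O.
Proof. by move=> le_Y; apply/dowling_of_le/gluef_kernel_le => o; apply/dowling_fun_le. Qed.

Lemma restr_glue Y o : restr o (glue Y) = Y o.
Proof.
rewrite /restr pullback_dowling_of -[RHS]dowling_funK.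
have E u : bind (@emb o) (gluef (fun o => dowling_fun (Y o))) u
    = omap (fun kg => (Tagged (fun o => {set F o}) kg.1, kg.2)) (dowling_fun (Y o) u).
  rewrite /bind /emb /gluef sK /sumf /=.
  by case: (dowling_fun _ _) => //= -[k g]; rewrite /= mulKVg.
apply: eq_dowling_of; apply: kernel_leP => [u|u v k g g']; rewrite ?E.
- by case: (dowling_fun _ _).
- case: (dowling_fun _ u) => [[k1 g1]|] //= [et <-].
  case: (dowling_fun _ v) => [[k2 g2]|] //= [et' <-].
  by move: et; rewrite -et' => /eqP; rewrite eq_Tagged => /eqP /= ->; rewrite mulgKV.
- by move=> ->.
by move=> -> ->; rewrite /= mulgKV.
Qed.

(** The case where both keys are [None] is included: the zero block of [y], too, must lie in a
    single component. *)
Definition separated (y : dowling T G) := forall a b,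
  key (dowling_fun y) a = key (dowling_fun y) b -> tag (s' a) = tag (s' b).

Lemma glue_restr y : separated y -> glue (restr^~ y) = y.
Proof.
move=> sep; pose fs o := bind (@emb o) (dowling_fun y).
have [le1 le2] : kernel_le (gluef (fun o => dowling_fun (restr o y))) (gluef fs)
    /\ kernel_le (gluef fs) (gluef (fun o => dowling_fun (restr o y))).
  by split; apply: gluef_kernel_le => o; have [] := dowling_of_kernel (fs o).
have E' a : gluef fs a
    = omap (fun kg => (existT (fun=> {set T}) (tag (s' a)) kg.1, kg.2)) (dowling_fun y a).
  rewrite /gluef /sumf /fs /bind /emb /= -[in s _]/(s' a).
  have -> : Tagged F (tagged (s' a)) = s' a by case: (s' a).
  by rewrite s'K; case: (dowling_fun y a) => //= -[k g]; rewrite /= mulKg.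
rewrite -[RHS]dowling_funK; apply: eq_dowling_of.
  apply: kernel_le_trans le1 _; apply: kernel_leP => [a|a b t u v]; rewrite !E'.
    by case: (dowling_fun y a).
  case: (dowling_fun y a) => [[k g]|] //= [et <-].
  case: (dowling_fun y b) => [[k' g']|] //= [et' <-].
  have /= -> := congr1 (fun z : {_ : O & {set T}} => tagged z) (etrans et (esym et')).
  by rewrite mulgKV.
apply: kernel_le_trans _ le2; apply: kernel_leP => [a|a b k u v ea eb];
  rewrite !E'; first by move->.
rewrite ea eb /= mulgKV; congr (Some (existT _ _ _, _)).
by apply: sep; rewrite /key ea eb.
Qed.

Lemma card_tagged o (P : pred D) (Q : pred (F o)) :
  (forall z, P z -> tag z = o) -> (forall u, P (Tagged F u) = Q u) ->
  #|[set a : T | P (s' a)]| = #|[set u | Q u]|.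
Proof.
move=> Po PQ; pose im (u : F o) := s (Tagged F u).
have inj : injective im.
  by move=> u v /(can_inj sK)/eqP; rewrite eq_Tagged => /eqP.
rewrite -(card_imset _ inj); apply: eq_card => a; rewrite inE.
apply/idP/imsetP => [Pa|[u]]; last by rewrite inE -PQ => Pu ->; rewrite sK.
have := Po _ Pa; case ea: (s' a) => [o' u] /= eo; subst o'.
exists u; last by rewrite /im -[a]s'K ea.
by rewrite inE -PQ -[Tagged _ _]/(existT _ o u) -ea.
Qed.

Lemma proj_tw z (J : Type) (o : option (J * G)) : proj pi (lact (tw z) o) = proj pi o.
Proof. by case: o => //= -[j g]; rewrite /proj /= piM pi_tw mul1g. Qed.

(** A block of [y] lies in one component, so on component [o] its classes are either kept whole or
    empty, and the twist does not move them. *)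
Lemma evend_restr y o : separated y -> evend pi q y -> evend pi q (restr o y).
Proof.
move=> sep ev; rewrite /restr /pullback; apply/(evend_dowling_of q piM) => j h.
pose e h := #|[set a | (proj pi (dowling_fun y a) == Some (j, h)) && (tag (s' a) == o)]|.
have cntE h' : class_size pi (bind (@emb o) (dowling_fun y)) j h' = e h'.
  pose P z := (proj pi (dowling_fun y (s z)) == Some (j, h')) && (tag z == o).
  transitivity #|[set a | P (s' a)]|; last first.
    by apply: eq_card => a; rewrite !inE /P s'K.
  apply/esym/card_tagged => [z /andP[_ /eqP//]|u].
  by rewrite /P /= eqxx andbT /bind /emb proj_tw.
rewrite !cntE.
have [a /= /andP[/eqP ka /eqP ta]|none] :=
  pickP (fun a => (key (dowling_fun y) a == Some j) && (tag (s' a) == o)).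
  have eE h' : e h' = class_size pi (dowling_fun y) j h'.
    apply: eq_card => b; rewrite !inE andb_idr // => /eqP pb.
    rewrite -ta; apply/eqP/sep; rewrite ka /key.
    by move: pb; rewrite /proj; case: (dowling_fun y b) => // -[i g] [-> _].
  by rewrite !eE; apply: ev.
have e0 h' : e h' = 0%N.
  apply: eq_card0 => a; rewrite !inE; apply/negP => /andP[/eqP pa ta].
  have := none a; rewrite ta andbT /key; move: pa; rewrite /proj.
  by case: (dowling_fun y a) => // -[i g] [-> _] /=; rewrite eqxx.
by rewrite !e0.
Qed.

Lemma evend_glue Y : (forall o, evend pi q (Y o)) -> evend pi q (glue Y).
Proof.
move=> ev; rewrite /glue; apply/(evend_dowling_of q piM) => -[o k] h.
have cntE h' : class_size pi (gluef (fun o => dowling_fun (Y o))) (existT _ o k) h'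
    = class_size pi (dowling_fun (Y o)) k h'.
  apply: (@card_tagged o (fun z => proj pi (sumf (fun o => dowling_fun (Y o)) z)
    == Some (Tagged (fun o => {set F o}) k, h'))).
    move=> [o' u]; rewrite /sumf /=; case: (dowling_fun _ _) => //= -[k' g].
    by rewrite (inj_eq (@Some_inj _)) xpair_eqE => /andP[/eqP/(congr1 tag)].
  move=> u; rewrite /sumf /=; case: (dowling_fun _ _) => //= -[k' g].
  rewrite !(inj_eq (@Some_inj _)) !xpair_eqE eq_Tagged /=.
  by rewrite piM (piV piM) pi_tw invg1 mul1g.
by rewrite !cntE; apply: ev.
Qed.

End Glue.

(** * Product decomposition of the ideal of even elements below [x] *)

Section Lower.
Variables (G H : finGroupType) (pi : G -> H) (q d : nat).
Hypothesis piM : {morph pi : x y / x * y}.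
Hypothesis q_gt0 : (0 < q)%N.
Variable clab : forall m, 'I_(d * m) -> G.
Hypothesis clabP : forall m h, (0 < m)%N ->
  #|[set u | pi (@clab m u) == h]| = (q * m)%N.

Definition ctop m : dowling 'I_(d * m) G := dowling_of (fun u => Some (tt, clab u)).

Section Decomposition.
Variables (T : finType) (x : dowling T G) (n : nat).
Hypothesis ev : evend pi q x.
Hypothesis le_n : forall j, (class_size pi (dowling_fun x) j 1%g <= q * n)%N.
Let f := dowling_fun x.
Let m := #|[set a | f a == None]|.

(** The ordinal [i] stands for the index [i.+1] of the type. As [q * i.+1] is positive, a set that
    is not a block of [x] is never counted. *)
Definition size_class (i : 'I_n) := [set j | class_size pi f j 1%g == q * i.+1]%N.
Definition mult (i : 'I_n) := #|size_class i|.
Local Notation A := {i : 'I_n & 'I_(mult i)}.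

Definition component_dim (o : option A) := if o is Some t then (d * (tag t).+1)%N else m.
Definition component (o : option A) : finType := 'I_(component_dim o).
Local Notation D := {o : option A & component o}.

Definition block_of (t : A) : {set T} := enum_val (tagged t : 'I_#|size_class (tag t)|).

Lemma block_of_size t : class_size pi f (block_of t) 1%g = (q * (tag t).+1)%N.
Proof. by have := enum_valP (tagged t : 'I_#|size_class (tag t)|); rewrite inE => /eqP. Qed.

Lemma block_of_inj : injective block_of.
Proof.
move=> [i u] [j v] e; have /= eij : i = j.
  apply/val_inj/eqP; rewrite -eqSS -(eqn_pmul2l q_gt0).
  by rewrite -(block_of_size (existT _ i u)) e block_of_size.
subst j; congr (existT _ _ _); exact: (enum_val_inj e).
Qed.

Definition component_fun (o : option A) : component o -> option ({set T} * G) :=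
  match o with
  | Some t => fun u => Some (block_of t, clab u)
  | None => fun=> None
  end.

(** This is the data to be matched by the bijection: block name and class of the label under [pi].
    The zero block gets the dummy class [1]. *)
Definition key_class (z : option ({set T} * G)) : option {set T} * H :=
  if z is Some (j, g) then (Some j, pi g) else (None, 1).

Lemma card_component (P : pred D) o (Q : pred (component o)) :
  (forall z, P z -> tag z = o) -> (forall u, P (Tagged component u) = Q u) ->
  #|[set z | P z]| = #|[set u | Q u]|.
Proof.
move=> Po PQ; have inj : injective (fun u : component o => Tagged component u).
  by move=> u v /eqP; rewrite eq_Tagged => /eqP.
rewrite -(card_imset _ inj); apply: eq_card => z; rewrite inE.
apply/idP/imsetP => [Pz|[u]]; last by rewrite inE -PQ => Pu ->.
have := Po _ Pz; case: z Pz => o' u /= Pz eo; subst o'; exists u => //.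
by rewrite inE -PQ.
Qed.

(** A block of [x] and the model [ctop] of the same size have equally many labels in each class, so
    [fibre_bij] matches the ground sets respecting blocks and classes. The remaining discrepancy of
    labels is the twist, killed by [pi]. *)
Lemma decomposition : exists (s : D -> T) (s' : T -> D) (tw : D -> G),
  [/\ cancel s s', cancel s' s, forall z, pi (tw z) = 1 &
   forall o (u : component o),
     lact (tw (Tagged component u)) (f (s (Tagged component u))) = component_fun u].
Proof.
have [|s [s' sK s'K] sP] := @fibre_bij D T (option {set T} * H)%type
    (fun z => key_class (component_fun (tagged z))) (fun a => key_class (f a)).
  move=> [[j|] h]; last first.
    have [->|nh] := eqVneq h 1; last first.
      rewrite !eq_card0 // => [a|[o u]]; rewrite !inE.
        by case: (f a) => [[j g]|] //=; rewrite xpair_eqE /= eq_sym (negPf nh).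
      by case: o u => [t|] u //=; rewrite xpair_eqE /= eq_sym (negPf nh).
    rewrite (@card_component _ None predT) => [|[[t|] u] //|u]; last by rewrite /= eqxx.
    have -> : [set u : component None | predT u] = setT by apply/setP => u; rewrite !inE.
    rewrite cardsT card_ord.
    rewrite /= /m; apply: eq_card => a; rewrite !inE.
    by case: (f a) => [[j g]|] //=; rewrite !eqxx.
  have -> : #|[set a | key_class (f a) == (Some j, h)]| = class_size pi f j h.
    by apply: eq_card => a; rewrite !inE; case: (f a) => [[i g]|].
  have [ejh /dvdnP[c ec]] := ev j h; rewrite -/f in ejh ec *.
  rewrite ejh; have [t ejt|none] := pickP (fun t => block_of t == j).
    rewrite -(eqP ejt) block_of_size -(@clabP _ h) //.
    apply: (@card_component _ (Some t)) => [[[t'|] u]|u] //=.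
      by rewrite xpair_eqE (inj_eq (@Some_inj _)) => /andP[/eqP/block_of_inj <- _].
    by rewrite xpair_eqE eqxx.
  (* If [j] is not among the enumerated blocks, its class size must be 0: a positive one is
     [q * c.+1] with [c < n], which would put [j] in some [size_class]. *)
  case: c ec => [|c] ec.
    rewrite ec mul0n; apply: eq_card0 => -[[t|] u]; rewrite inE //=.
    by rewrite xpair_eqE (inj_eq (@Some_inj _)) none.
  have lt_c : (c < n)%N.
    by have := le_n j; rewrite -/f ec mulnC leq_pmul2l.
  have jK : j \in size_class (Ordinal lt_c) by rewrite inE ec mulnC.
  have := none (existT (fun i => 'I_(mult i)) (Ordinal lt_c) (enum_rank_in jK j)).
  by rewrite /block_of /= enum_rankK_in ?eqxx.
pose tw z := match component_fun (tagged z), f (s z) with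
  Some (_, g), Some (_, g') => g * g'^-1 | _, _ => 1 end.
have pi1 : pi 1 = 1 by apply: (mulgI (pi 1)); rewrite -piM !mulg1.
exists s, s', tw; split=> // [z|o u].
  rewrite /tw; have := sP z.
  case: (component_fun _) => [[j g]|] //; case: (f (s z)) => [[j' g']|] //=.
  by case=> _ e; rewrite piM (piV piM) e mulgV.
rewrite /tw; have /= := sP (Tagged component u).
case: (component_fun _) => [[j g]|] //; case: (f _) => [[j' g']|] //=.
by case=> -> _; rewrite mulgKV.
Qed.

End Decomposition.

(** Here [U], [V0] and [R m] are abstract copies of the even elements below [x], on the zero block
    of [x], and below [ctop m]. Restriction to the components and gluing are monotone, preserve
    evenness and are inverse to each other below [x]. *)
Lemma lower_poset_iso (T : finType) (x : dowling T G) (n : nat)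
    (U V0 : finPOrderType poset_display) (R : nat -> finPOrderType poset_display)
    (w : U -> dowling T G)
    (w0 : V0 -> dowling 'I_#|[set a | dowling_fun x a == None]| G)
    (wR : forall m, R m -> dowling 'I_(d * m) G) :
  evend pi q x -> (forall j, (class_size pi (dowling_fun x) j 1%g <= q * n)%N) ->
  {mono w : u v / (u <= v)%O} -> {mono w0 : u v / (u <= v)%O} ->
  (forall m, {mono (@wR m) : u v / (u <= v)%O}) ->
  (forall u, (w u <= x)%O /\ evend pi q (w u)) ->
  (forall y, (y <= x)%O -> evend pi q y -> exists u, w u = y) ->
  (forall u, evend pi q (w0 u)) ->
  (forall y, evend pi q y -> exists u, w0 u = y) ->
  (forall m u, (0 < m)%N -> (@wR m u <= ctop m)%O /\ evend pi q (@wR m u)) ->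
  (forall m y, (0 < m)%N -> (y <= ctop m)%O -> evend pi q y -> exists u, @wR m u = y) ->
  exists a : 'I_n -> nat, poset_iso U (V0 *prod[poset_display] type_prod R a).
Proof.
move=> ev le_n wmono w0mono wRmono wP wsurj w0P w0surj wRP wRsurj.
have [s [s' [tw [sK s'K pi_tw sP]]]] := decomposition ev le_n.
exists (mult x (n := n)).
pose A := {i : 'I_n & 'I_(mult x i)}.
pose rs (o : option A) y := restr s tw o y.
(* Elements in a common block of [y] share a block of [x], and distinct components carry distinct
   blocks of [x]. *)
have sep y : (y <= x)%O -> separated s' y.
  move=> /dowling_fun_le yx a b /(kernel_le_key yx); rewrite -{1}(s'K a) -{1}(s'K b) /key.
  case: (s' a) => o u; case: (s' b) => o' v /=.
  have := sP _ u; have := sP _ v; rewrite /Tagged.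
  case: (dowling_fun x _) => [[k g]|]; case: (dowling_fun x _) => [[k' g']|] //=.
    case: o' v => [t'|] v //= [e _]; case: o u => [t|] u //= [e' _] [ek].
    by congr Some; apply: (block_of_inj ); rewrite -e -e'.
  by case: o' v => [t'|] v //= _; case: o u.
have rE o : rs o x = dowling_of (@component_fun T x n o).
  rewrite /rs /restr -[X in pullback _ X]dowling_funK pullback_dowling_of.
  by apply: eq_dowling_of_fun => u; rewrite /bind /emb sP.
have rtop (t : A) : rs (Some t) x = ctop (tag t).+1.
  rewrite rE; apply: eq_dowling_of; apply: kernel_leP => [//|u v k g g' [_ <-] [_ <-]].
    by rewrite /= mulgKV.
  by rewrite /= mulgKV.
have evr o y : (y <= x)%O -> evend pi q y -> evend pi q (rs o y).
  by move=> /sep; apply: (evend_restr piM sK s'K pi_tw).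
have glueK y : (y <= x)%O -> glue s' tw (rs^~ y) = y.
  by move=> /sep; apply: (glue_restr tw s'K).
pose Rel u (v : V0 *prod[poset_display] type_prod R (mult x (n := n))) :=
  (w0 v.1 == rs None (w u)) &&
  [forall t : A, @wR (tag t).+1 (v.2 t) == rs (Some t) (w u)].
apply: (@poset_iso_rel _ _ U (V0 *prod[poset_display] type_prod R (mult x (n := n))) Rel).
- move=> u; have [lex evu] := wP u.
  have [v0 ev0] := w0surj (rs None (w u)) (evr None _ lex evu).
  have /fin_all_exists[v evt] (t : A) : exists v : R (tag t).+1, wR _ v = rs (Some t) (w u).
    apply: wRsurj => //; last exact: (evr (Some t)).
    by rewrite -rtop; apply: pullback_le.
  exists (v0, finfun v); rewrite /Rel /= ev0 eqxx /=.
  by apply/forallP => t; rewrite ffunE evt.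
- move=> [v0 v].
  pose Y (o : option A) : dowling (@component T x n o) G :=
    match o with Some t => @wR _ (v t) | None => w0 v0 end.
  have evY o : evend pi q (Y o).
    by case: o => [t|] /=; [case: (wRP (tag t).+1 (v t))|exact: w0P].
  have [||u eu] := wsurj (glue s' tw Y).
  - rewrite -[X in (_ <= X)%O](glueK x (lexx x)); apply: glue_le => -[t|].
      by rewrite rtop; case: (wRP (tag t).+1 (v t)).
    (* On the zero component, [x] restricts to the greatest element, so [v0] is unconstrained
       there. *)
    by rewrite rE -[X in (X <= _)%O]dowling_funK; apply/dowling_of_le; split.
  - exact: evend_glue evY.
  exists u; rewrite /Rel eu /rs; apply/andP; split.
    by rewrite (restr_glue tw sK Y None).
  by apply/forallP => t; rewrite (restr_glue tw sK Y (Some t)).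
move=> u u' [v0 v] [v0' v'] /andP[/= /eqP e0 /forallP e] /andP[/= /eqP e0' /forallP e'].
rewrite -wmono leEprod /= -w0mono e0 e0'; apply/idP/idP.
  move=> le_w; apply/andP; split; first exact: pullback_le.
  apply/forallP => t; rewrite -wRmono (eqP (e t)) (eqP (e' t)).
  exact: pullback_le.
case/andP=> le0 /forallP le_v.
have [lew _] := wP u; have [lew' _] := wP u'.
rewrite -(glueK _ lew) -(glueK _ lew'); apply: glue_le => -[t|] //.
by have := le_v t; rewrite -wRmono (eqP (e t)) (eqP (e' t)).
Qed.

End Lower.

(** * Labels modulo k *)

Lemma mu_val m n : (0 < m)%N -> (inZp n : mu m) = n %% m :> nat.
Proof. by move=> m_gt0; rewrite /= prednK. Qed.

Lemma mu_valM m (x y : mu m) : (0 < m)%N -> (x * y)%g = (x + y) %% m :> nat.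
Proof. exact: mu_val. Qed.

Lemma mu_lt m (x : mu m) : (0 < m)%N -> (x < m)%N.
Proof. by move=> m_gt0; rewrite -[X in (_ < X)%N](prednK m_gt0). Qed.

Section Residues.
Variables (r k d : nat).
Hypotheses (r_gt0 : (0 < r)%N) (k_gt0 : (0 < k)%N) (d_gt0 : (0 < d)%N).
Hypotheses (kd : (k %| d)%N) (kr : (k %| r)%N).

Definition residue (x : mu r) : mu k := inZp x.
Let q := (d %/ k)%N.

Lemma residueE x : residue x = x %% k :> nat.
Proof. exact: mu_val. Qed.

Lemma residueM : {morph residue : x y / x * y}.
Proof.
move=> x y; apply/ord_inj; rewrite residueE !mu_valM // !residueE.
by rewrite modn_dvdm // modnDml modnDmr.
Qed.

Lemma residue_surj h : exists g, residue g = h.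
Proof.
exists (inZp h); apply/ord_inj; rewrite residueE mu_val // modn_dvdm //.
by rewrite modn_small // mu_lt.
Qed.

Lemma divisor_split : d = (k * q)%N. Proof. by rewrite mulnC divnK. Qed.

Lemma q_gt0 : (0 < q)%N.
Proof. by rewrite divn_gt0 // dvdn_leq. Qed.

Lemma card_mu : #|{: mu k}| = k. Proof. by rewrite card_ord prednK. Qed.

Definition clab m (i : 'I_(d * m)) : mu r := inZp ((i * k) %/ (d * m) + 1).

(** The labels of [c_elt] are constant on [k] consecutive runs of length [q * m], and the values on
    these runs exhaust the residues mod [k] once each. *)
Lemma clab_card m (h : mu k) : (0 < m)%N ->
  #|[set u : 'I_(d * m) | residue (clab u) == h]| = (q * m)%N.
Proof.
move=> m_gt0; pose M := (q * m)%N; have M_gt0 : (0 < M)%N by rewrite muln_gt0 q_gt0.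
have dmE : (d * m = k * M)%N by rewrite mulnA -divisor_split.
have hk : (h < k)%N := mu_lt h k_gt0.
(* The index of the run with residue [h] is [h - 1] mod [k], because labels are shifted by one;
   adding [k.-1] avoids truncated subtraction. *)
pose c := ((h + k.-1) %% k)%N.
have ck : (c < k)%N by rewrite ltn_mod.
have ltc (v : 'I_M) : (c * M + v < d * m)%N.
  rewrite dmE; apply: (@leq_trans (c.+1 * M)); last by rewrite leq_mul2r ck orbT.
  by rewrite mulSn addnC ltn_add2r.
have inj : injective (fun v => Ordinal (ltc v)).
  by move=> v w [] /addnI e; apply/val_inj.
rewrite -[RHS]card_ord -/M -cardsT -(card_imset _ inj); apply: eq_card => u.
have labE : (residue (clab u) == h) = ((u %/ M + 1) %% k == h)%N.
  by rewrite -(inj_eq (@ord_inj _)) residueE mu_val // modn_dvdm //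
    [X in (_ %/ X)%N]dmE [(u * k)%N]mulnC divnMl.
rewrite inE labE.
have uk : (u %/ M < k)%N by rewrite ltn_divLR // -dmE.
apply/eqP/imsetP => [eh|[v _ ->]].
  have uc : (u %/ M = c)%N.
    rewrite /c -eh modnDml -addnA add1n prednK // modnDr modn_small //.
  have ltv : (u %% M < M)%N by rewrite ltn_mod.
  by exists (Ordinal ltv) => //; apply/val_inj; rewrite /= -uc -divn_eq.
rewrite /= divnMDl // divn_small // addn0 /c modnDml -addnA addn1 [X in (h + X)%N]prednK //.
by rewrite modnDr modn_small.
Qed.

(** When its [k] classes are equal, a block has [k] times the size of a class, so [d = k * q]
    divides the former iff [q] divides the latter. *)
Lemma even_prep N (p : prepart 'I_N (mu r)) :
  evenf residue q (prep_fun p) <-> [forall B in blocks p, (d %| #|B|)%N &&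
    [forall j : 'I_k, forall j' : 'I_k,
      #|[set a in B | label p a == j %[mod k]]|
      == #|[set a in B | label p a == j' %[mod k]]|]].
Proof.
have cntE B (h : mu k) : B \in blocks p ->
    class_size residue (prep_fun p) B h = #|[set a in B | label p a == h %[mod k]]|.
  move=> pB; apply: eq_card => a; rewrite !inE.
  case: (boolP (a \in B)) => aB.
    rewrite (prep_fun_block pB aB) /proj /= (inj_eq (@Some_inj _)) xpair_eqE eqxx /=.
    rewrite -(inj_eq (@ord_inj _)) residueE [in RHS](@modn_small h) //.
    exact: mu_lt.
  apply/negP; rewrite /proj /prep_fun; case: ifP => //= /negbT za /eqP[eB _].
  by case/negP: aB; rewrite -eB (prep_cover za).
have cnt0 B h : B \notin blocks p -> class_size residue (prep_fun p) B h = 0%N.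
  move=> pB; apply: eq_card0 => a; rewrite !inE; apply/negP.
  rewrite /proj /prep_fun; case: ifP => //= /negbT za /eqP[eB _].
  by case/negP: pB; rewrite -eB (prep_cover za).
have cntj B (j : 'I_k) : B \in blocks p ->
    #|[set a in B | label p a == j %[mod k]]| = class_size residue (prep_fun p) B (inZp j).
  by move=> pB; rewrite cntE //; apply: eq_card => a; rewrite !inE mu_val // modn_mod.
have cardB B : B \in blocks p -> #|B| = (\sum_h class_size residue (prep_fun p) B h)%N.
  move=> pB; have -> : #|B| = #|[set a | a \in B]| by apply: eq_card => a; rewrite inE.
  rewrite (card_fibres _ (fun a => residue (label p a))); apply: eq_bigr => h _.
  rewrite cntE //; apply: eq_card => a; rewrite !inE -(inj_eq (@ord_inj _)) residueE.
  by rewrite (modn_small (mu_lt h k_gt0)).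
split.
  move=> ev; apply/forall_inP => B pB; apply/andP; split.
    rewrite cardB // (eq_bigr (fun=> class_size residue (prep_fun p) B 1)); last first.
      by move=> h _; case: (ev B h).
    by rewrite sum_nat_const card_mu [X in (X %| _)%N]divisor_split dvdn_mul //; case: (ev B 1).
  apply/forallP => j; apply/forallP => j'; rewrite !cntj //.
  by rewrite (ev B (inZp j)).1 (ev B (inZp j')).1.
move/forall_inP => ev B h; case: (boolP (B \in blocks p)) => pB; last by rewrite !cnt0.
have /andP[dB /forallP eqB] := ev B pB.
have cst h' : class_size residue (prep_fun p) B h' = class_size residue (prep_fun p) B 1.
  (* Residues in [mu k] have type ['I_k.-1.+1] and are cast to ['I_k] to apply the hypothesis. *)
  have e := prednK k_gt0.
  have /eqP := forallP (eqB (cast_ord e h')) (cast_ord e 1); rewrite -!cntE //.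
split=> //; move: dB; rewrite cardB // (eq_bigr _ (fun h _ => cst h)).
by rewrite sum_nat_const card_mu [X in (X %| _)%N]divisor_split dvdn_pmul2l.
Qed.

Lemma even_blocksP N (x : DowlingQ N (mu r)) :
  even_blocks d k x <-> evend residue q x.
Proof.
split=> [/forall_inP ev|ev].
  by apply/even_prep/ev/rep_mem.
apply/forall_inP => p xp; apply/even_prep.
have /dowling_class_eq/prepart_eqv_kernel[_ h] :
    dowling_class p = dowling_class (rep x).
  by rewrite -(mem_dowling xp) -(mem_dowling (rep_mem x)).
exact: (evenf_kernel_le residueM h ev).
Qed.

Lemma c_eltE n : (0 < n)%N -> c_elt r d k n = ctop (@clab) n.
Proof.
move=> n_gt0; rewrite /c_elt; set p := Prepart _.
rewrite -[LHS]dowling_funK; have /dowling_class_eq/prepart_eqv_kernel[h1 h2] :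
    dowling_class (rep (dowling_class p)) = dowling_class p.
  by rewrite -(mem_dowling (rep_mem _)).
have pE a : prep_fun p a = Some (setT, clab a).
  rewrite (@prep_fun_block _ _ p setT) ?inE ?eqxx ?andbT //.
    by rewrite /label /= ffunE.
  by apply/set0Pn; exists a.
apply: eq_dowling_of.
  apply: kernel_le_trans h1 _; apply: kernel_leP => [a|a b B u v]; rewrite !pE //.
  by move=> [_ <-] [_ <-]; rewrite /= mulgKV.
apply: kernel_le_trans _ h2; apply: kernel_leP => [//|a b j u v [_ <-] [_ <-]].
by rewrite !pE /= mulgKV.
Qed.

Lemma evend_ctop n : (0 < n)%N -> evend residue q (ctop (@clab) n).
Proof.
move=> n_gt0; apply/(evend_dowling_of q residueM) => -[] h.
have E h' : class_size residue (fun u : 'I_(d * n) => Some (tt, clab u)) tt h' = (q * n)%N.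
  rewrite -(clab_card h' n_gt0); apply: eq_card => u; rewrite !inE /proj /=.
  by rewrite (inj_eq (@Some_inj _)) xpair_eqE.
by rewrite !E dvdn_mulr.
Qed.

Lemma nblocks_ctop n : (0 < n)%N -> nblocks (ctop (@clab) n) = 1%N.
Proof.
move=> n_gt0; rewrite nblocks_dowling_of -[RHS]card_unit -cardsT; apply: eq_card => -[].
have dn : (0 < d * n)%N by rewrite muln_gt0 d_gt0.
by rewrite !inE; apply/existsP; exists (Ordinal dn).
Qed.

End Residues.

(** * The exponential structures *)

Lemma val_mono d (T : finPOrderType d) (P : pred T) :
  {mono (val : subposet P -> T) : x y / (x <= y)%O}.
Proof. exact: Order.le_val. Qed.

(** This discards the zero-block factor of a lower ideal when the zero block is empty; an element of
    [U] provides the single element of [V]. *)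
Lemma poset_iso_drop_subsingleton (U V P : finPOrderType poset_display) :
  inhabited U -> (forall v v' : V, v = v') ->
  poset_iso U (V *prod[poset_display] P) -> poset_iso U P.
Proof.
move=> [u0] allV [f [bf mf]]; exists (fun u => (f u).2); split.
  have [g gK fK] := bf; exists (fun p => g ((f u0).1, p)) => [u|p].
    by rewrite -[RHS]gK (surjective_pairing (f u)); congr (g (_, _)); apply: allV.
  by rewrite fK.
move=> u v; rewrite -mf leEprod (allV (f u).1 (f v).1) lexx.
by [].
Qed.

Section Main.
Variables (r k d e : nat).
Hypotheses (r_gt0 : (0 < r)%N) (k_gt0 : (0 < k)%N) (d_gt0 : (0 < d)%N).
Hypotheses (kd : (k %| d)%N) (kr : (k %| r)%N) (ed : (e < d)%N).
Let q := (d %/ k)%N.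
Let hq := q_gt0 k_gt0 d_gt0 kd.
Let hM := residueM r_gt0 k_gt0 kr.
Let evP N := @even_blocksP r k d r_gt0 k_gt0 kd kr N.
Local Notation ev := (evend (@residue r k) q).
Local Notation top n := (ctop (@clab r k d) n).

Definition even_poset N : finPoset := subposet [pred x : DowlingQ N (mu r) | even_blocks d k x].

Lemma nblocks_bound N n (x : DowlingQ N (mu r)) : (N < d * n.+1)%N -> ev x ->
  (nblocks x <= n)%N.
Proof.
move=> ltN /card_nblocks; rewrite card_mu // -divisor_split // card_ord => le_N.
by rewrite -ltnS -(ltn_pmul2l d_gt0) (leq_ltn_trans le_N).
Qed.

Lemma class_size_bound N n (x : DowlingQ N (mu r)) j : (N < d * n.+1)%N -> ev x ->
  (class_size (@residue r k) (dowling_fun x) j 1%g <= q * n)%N.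
Proof.
move=> ltN evx; have [_ /dvdnP[c ec]] := evx j 1; rewrite ec mulnC leq_mul2l.
apply/orP; right; rewrite -ltnS -(ltn_pmul2l d_gt0); apply: leq_ltn_trans ltN.
rewrite -[X in (_ <= X)%N]card_ord
  (leq_trans _ (max_card [set a | key (dowling_fun x) a == Some j])) //.
by rewrite (key_size evx) card_mu // ec [X in (X * c <= _)%N](divisor_split kd)
  -mulnA [(c * _)%N]mulnC.
Qed.

Lemma exists_smaller N (x : DowlingQ N (mu r)) : ev x -> (d * (nblocks x).+1 <= N)%N ->
  exists2 y, (y < x)%O & ev y.
Proof.
move=> evx leN; apply: (split_even hM (residue_surj r_gt0 k_gt0 kr) hq) => //.
by rewrite card_mu // -divisor_split // card_ord.
Qed.

(** * Grading of the even elements below a given one *)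

Section Embedded.
Variables (N n : nat) (ltN : (N < d * n.+1)%N) (leN : (d * n <= N)%N).
Variables (U : finPOrderType poset_display) (w : U -> DowlingQ N (mu r)) (t : U).
Hypotheses (w_mono : {mono w : u v / (u <= v)%O}) (w_ev : forall u, ev (w u)).
Hypothesis w_t : forall u, (w u <= w t)%O.
Hypothesis w_surj : forall y, ev y -> (y <= w t)%O -> exists u, w u = y.

(** At most [n] nonzero blocks of size divisible by [d] fit into [N < d * n.+1] points, and an even
    element with fewer than [n] can be refined since [d * n <= N]; so minimal elements have exactly
    [n] blocks. *)
Let rho u := (n - nblocks (w u))%N.

Lemma embed_lt u v : (u < v)%O = (w u < w v)%O.
Proof. by rewrite !lt_leAnge !w_mono. Qed.

Lemma embed_top u : (u <= t)%O. Proof. by rewrite -w_mono. Qed.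

Lemma embed_nblocks u : (nblocks (w u) <= n)%N.
Proof. exact: nblocks_bound ltN (w_ev u). Qed.

Lemma embed_rho_lt u v : (u < v)%O -> (rho u < rho v)%N.
Proof.
by rewrite embed_lt => /nblocks_lt lt; rewrite ltn_sub2l // (leq_trans lt) // embed_nblocks.
Qed.

Lemma embed_rho_step u v : (u < v)%O ->
  exists z, [/\ (u < z)%O, (z <= v)%O & rho z = (rho u).+1].
Proof.
rewrite embed_lt => /nblocks_step[y [ltuy leyv ey]].
have [|z ez] := w_surj _ (le_trans leyv (w_t v)).
  exact: (evend_le hM (ltW ltuy) (w_ev u)).
exists z; rewrite embed_lt -w_mono ez; split=> //.
by rewrite /rho ez ey subnSK // -ey embed_nblocks.
Qed.

Lemma embed_rho_min u : (0 < rho u)%N -> exists v, (v < u)%O.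
Proof.
rewrite subn_gt0 => lt_n; have [|y ltyu evy] := exists_smaller (w_ev u).
  by apply: leq_trans leN; rewrite leq_mul2l lt_n orbT.
have [v ev] := w_surj evy (le_trans (ltW ltyu) (w_t u)).
by exists v; rewrite embed_lt ev.
Qed.

Lemma embed_max : exists! t : U, is_maximal t.
Proof. exact: graded_ex_maximal embed_top. Qed.

Lemma embed_maximal t' : is_maximal t' -> t' = t.
Proof. exact: graded_maximal embed_top _. Qed.

Lemma embed_chain (C : {set U}) : is_max_chain C -> #|C| = (n - nblocks (w t)).+1.
Proof. exact: (graded_max_chain embed_top embed_rho_lt embed_rho_step embed_rho_min). Qed.

Lemma embed_rank u : (n - rank u)%N = nblocks (w u).
Proof.
rewrite (graded_rank embed_top embed_rho_lt embed_rho_step embed_rho_min).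
by rewrite subKn ?embed_nblocks.
Qed.

End Embedded.

Section R'seq.
Variables (n : nat) (n_gt0 : (0 < n)%N).
Lemma R'_seqP (u : R'_seq r d k n) : ev (val u) /\ (val u <= top n)%O.
Proof. by have /andP[/evP e1 e2] := valP u; rewrite -c_eltE. Qed.

Lemma R'_seq_ex y : ev y -> (y <= top n)%O -> exists u : R'_seq r d k n, val u = y.
Proof.
move=> evy leyc; have h : [pred x | even_blocks d k x & (x <= c_elt r d k n)%O] y.
  by rewrite /= c_eltE // leyc andbT; apply/evP.
by exists (exist _ y h).
Qed.

Lemma R'_seq_top : exists t : R'_seq r d k n, val t = top n.
Proof. by apply: R'_seq_ex => //; apply: evend_ctop. Qed.

End R'seq.

Lemma even_poset_ex N (y : DowlingQ N (mu r)) : ev y -> exists u : even_poset N, val u = y.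
Proof.
move=> evy; have h : [pred x | even_blocks d k x] y by apply/evP.
by exists (exist _ y h).
Qed.

Lemma even_posetP N (u : even_poset N) : ev (val u).
Proof. by have /evP := valP u. Qed.

Lemma lower_iso N n (x : DowlingQ N (mu r)) (U : finPoset) (w : U -> DowlingQ N (mu r)) :
  (N < d * n.+1)%N -> ev x -> {mono w : u v / (u <= v)%O} ->
  (forall u, (w u <= x)%O /\ ev (w u)) ->
  (forall y, (y <= x)%O -> ev y -> exists u, w u = y) ->
  exists a : 'I_n -> nat,
    poset_iso U (even_poset #|[set a | dowling_fun x a == None]| *prod[poset_display]
                 type_prod (fun m => R'_seq r d k m) a).
Proof.
move=> ltN evx wm wP wex.
apply: (lower_poset_iso hM hq (clab_card r_gt0 k_gt0 d_gt0 kd kr)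
  (x := x) (n := n) (U := U) (V0 := even_poset #|[set a | dowling_fun x a == None]|)
  (R := fun m => R'_seq r d k m)
  (w := w) (w0 := val) (wR := fun m (u : R'_seq r d k m) => val u)) => //.
- by move=> j; apply: class_size_bound.
- exact: even_posetP.
- exact: even_poset_ex.
- by move=> m u m_gt0; have [] := R'_seqP m_gt0 u.
by move=> m y m_gt0 ? ?; apply: R'_seq_ex.
Qed.

Lemma ground_lt n : (d * n + e < d * n.+1)%N.
Proof. by rewrite mulnS addnC ltn_add2r. Qed.

(** Nonzero blocks cover a multiple of [d] points, so the zero block keeps the remainder [e], and
    the even elements on it form the poset with index [b]. *)
Lemma zero_card N n (x : DowlingQ N (mu r)) : N = (d * n + e)%N -> ev x ->
  exists b, #|[set a | dowling_fun x a == None]| = (d * b + e)%N.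
Proof.
move=> eN evx; have := card_ground evx; rewrite card_ord card_mu //.
have /dvdnP[c ->] : (q %| \sum_j class_size (@residue r k) (dowling_fun x) j 1%g)%N.
  by apply: dvdn_sum => j _; case: (evx j 1).
set m := #|_|; rewrite [(c * _)%N]mulnC mulnA -divisor_split // eN => em.
have le_cn : (c <= n)%N.
  rewrite -ltnS -(ltn_pmul2l d_gt0); apply: leq_ltn_trans (ground_lt n).
  by rewrite em leq_addl.
exists (n - c)%N; apply/eqP; rewrite -(eqn_add2r (d * c)) -em addnAC -mulnDr subnK //.
Qed.

Lemma R'_exponential : exponential_structure (fun n => R'_seq r d k n).
Proof.
(* The denominator sequence is taken to be the count of minimal elements itself. *)
exists (fun n => #|[set x : R'_seq r d k n | is_minimal x]|).
have lt_dn n : (d * n < d * n.+1)%N by rewrite ltn_pmul2l.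
have R'ev n (n_gt0 : (0 < n)%N) (u : R'_seq r d k n) : ev (val u) := (R'_seqP n_gt0 u).1.
split=> // n n_gt0; have [t et] := R'_seq_top n_gt0.
- have t_top (u : R'_seq r d k n) : (val u <= val t)%O by rewrite et (R'_seqP n_gt0 u).2.
  exact: embed_max (@val_mono _ _ _) t_top.
- move=> C.
  have t_top (u : R'_seq r d k n) : (val u <= val t)%O by rewrite et (R'_seqP n_gt0 u).2.
  have ex y : ev y -> (y <= val t)%O -> exists u : R'_seq r d k n, val u = y.
    by rewrite et; apply: R'_seq_ex.
  move/(embed_chain (lt_dn n) (leqnn _) (@val_mono _ _ _) (R'ev n n_gt0) t_top ex) => ->.
  (* The top has one nonzero block, so a maximal chain has [(n - 1).+1 = n] elements. *)
  by rewrite et nblocks_ctop // subn1 prednK.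
- move=> x t' mt'.
  have t_top (u : R'_seq r d k n) : (val u <= val t)%O by rewrite et (R'_seqP n_gt0 u).2.
  have ex y : ev y -> (y <= val t)%O -> exists u : R'_seq r d k n, val u = y.
    by rewrite et; apply: R'_seq_ex.
  rewrite (embed_rank (lt_dn n) (leqnn _) (@val_mono _ _ _) (R'ev n n_gt0) t_top ex).
  rewrite (embed_maximal (@val_mono _ _ _) t_top mt').
  have [phi [s [xphi phis]]] := section_ex (val x).
  apply: (upper_pi_iso xphi phis (R'_seqP n_gt0 x).2
    (w := fun u : poset_interval x t => val (val u))).
  + by move=> u v; rewrite !val_mono.
  + by move=> u; rewrite -[dowling_of _]/(top n) -et !val_mono; apply: (valP u).
  move=> z /andP[xz zt]; have evz : ev z := evend_le hM xz (R'ev n n_gt0 x).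
  have zt' : (z <= val t)%O by rewrite et.
  have [u eu] := ex z evz zt'.
  have h : (x <= u <= t)%O by rewrite -!val_mono eu xz.
  by exists (exist _ u h).
move=> x; have [evx lex] := R'_seqP n_gt0 x.
have [|||a] := @lower_iso _ n (val x) (lower_ideal x) (fun u => val (val u)) (lt_dn n) evx.
- by move=> u v; rewrite !val_mono.
- by move=> u; split; [rewrite val_mono; apply: (valP u)|apply: R'ev].
- move=> y leyx evy; have [u eu] := R'_seq_ex n_gt0 evy (le_trans leyx lex).
  have h : (u <= x)%O by rewrite -val_mono eu.
  by exists (exist _ u h).
(* Nothing below [top n] has a zero block, so the first factor of [lower_iso] is a Dowling poset on
   no points. *)
have -> : #|[set a | dowling_fun (val x) a == None]| = 0%N.
  by apply: eq_card0 => i; rewrite inE (negPf (below_Some i lex)).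
move=> iso; exists a; apply: poset_iso_drop_subsingleton iso.
  by constructor; exists x; rewrite inE.
move=> u v; apply/val_inj; rewrite -[LHS]dowling_funK -[RHS]dowling_funK.
by apply: eq_dowling_of_fun => -[].
Qed.

Lemma S_exponential_Dowling :
  exponential_Dowling_structure (mu r)
    (fun n => R'_seq r d k n) (fun n => S_seq r d e k n).
Proof.
exists (fun n => #|[set x : S_seq r d e k n | is_minimal x]|).
have le_dne n : (d * n <= d * n + e)%N by apply: leq_addr.
have even_val n (u : S_seq r d e k n) : ev (val u) := even_posetP u.
(* The greatest element has everything in the zero block. It has no nonzero block, which gives
   chains of [n.+1] elements. *)
pose one n : DowlingQ (d * n + e) (mu r) := dowling_of (fun=> None : option (unit * mu r)).
have le_one n y : (y <= one n)%O.
  by rewrite -[y]dowling_funK; apply/dowling_of_le; split.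
have ev_one n : ev (one n).
  apply/(evend_dowling_of q hM) => j h.
  have c0 h' : class_size (@residue r k) (fun=> None : option (unit * mu r)) j h' = 0%N.
    by apply: eq_card0 => a; rewrite inE.
  by rewrite !c0.
have nb_one n : nblocks (one n) = 0%N.
  rewrite nblocks_dowling_of; apply: eq_card0 => j; rewrite inE.
  by apply/existsP => -[].
have ex_one n : exists t : S_seq r d e k n, val t = one n by apply: even_poset_ex.
split=> //; first exact: R'_exponential.
- move=> n; have [t et] := ex_one n.
  have t_top (u : S_seq r d e k n) : (val u <= val t)%O by rewrite et le_one.
  exact: embed_max (@val_mono _ _ _) t_top.
- move=> n C; have [t et] := ex_one n.
  have t_top (u : S_seq r d e k n) : (val u <= val t)%O by rewrite et le_one.
  have ex y : ev y -> (y <= val t)%O -> exists u : S_seq r d e k n, val u = y.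
    by move=> evy _; apply: even_poset_ex.
  move/(embed_chain (ground_lt n) (le_dne n) (@val_mono _ _ _) (even_val n) t_top ex) => ->.
  by rewrite et nb_one subn0.
- move=> n x t' mt'; have [t et] := ex_one n.
  have t_top (u : S_seq r d e k n) : (val u <= val t)%O by rewrite et le_one.
  have ex y : ev y -> (y <= val t)%O -> exists u : S_seq r d e k n, val u = y.
    by move=> evy _; apply: even_poset_ex.
  rewrite (embed_rank (ground_lt n) (le_dne n) (@val_mono _ _ _) (even_val n) t_top ex).
  rewrite (embed_maximal (@val_mono _ _ _) t_top mt').
  have [phi [s [xphi phis]]] := section_ex (val x).
  apply: (upper_poset_iso xphi phis (w := fun u : poset_interval x t => val (val u))).
  + by move=> u v; rewrite !val_mono.
  + by move=> u; rewrite val_mono; have /andP[] := valP u.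
  move=> z xz; have evz : ev z := evend_le hM xz (even_val n x).
  have [u eu] := even_poset_ex evz.
  have h : (x <= u <= t)%O by rewrite -!val_mono eu xz et le_one.
  by exists (exist _ u h).
move=> n x; have [b eb] := zero_card erefl (even_val n x).
have [|||a] := @lower_iso _ n (val x) (lower_ideal x) (fun u => val (val u))
  (ground_lt n) (even_val n x).
- by move=> u v; rewrite !val_mono.
- by move=> u; split; [rewrite val_mono; apply: (valP u)|apply: even_val].
- move=> y leyx evy; have [u eu] := even_poset_ex evy.
  have h : (u <= x)%O by rewrite -val_mono eu.
  by exists (exist _ u h).
by rewrite eb => iso; exists b, a.
Qed.

End Main.

Local Close Scope group_scope.

Theorem lemma4p7 (d r k e : nat)
    (hd : 1 <= d) (hr : 1 <= r) (hk : 1 <= k) (he : e < d)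
    (hkd : k %| d) (hkr : k %| r) :
  exponential_Dowling_structure (mu r)
    (fun n => R'_seq r d k n) (fun n => S_seq r d e k n).
Proof. exact: S_exponential_Dowling. Qed.
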